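(* Let $(X,T,\mu)$ be a probability preserving ergodic dynamical system and let $f\in\mathcal{F}$. Then there exist a sequence $k(N)\in\mathbb{N}$ with $k(N)=o(N)$ and a sequence $d_N>0$ such that $$\lim_{N\to\infty}\frac{S_N^{k(N)}(f)(x)}{d_N}=1\qquad\text{for }\mu\text{-a.e. }x\in X.$$ Furthermore, if $(X,T,\mu)$ is uniquely ergodic, $\mu$ is regular and $f$ is continuous, then $k(N)$ and $d_N$ can be chosen such that this convergence holds uniformly over all $x\in X$.
   Context: $\mathcal{F}$ is the set of measurable $f:X\to[0,\infty]$ with $\int_X f\,d\mu=\infty$ and $\mu(f=\infty)=0$. For integers $N\ge 1$ and $0\le k\le N$ the trimmed sum is $$S_N^{k}(f)(x)=\sum_{n=0}^{N-1}f(T^nx)-\max_{0\le n_1<\dots<n_k\le N-1}\sum_{j=1}^{k}f(T^{n_j}x),$$ i.e. the Birkhoff sum with the $k$ largest terms removed; $S_N^M(f)=0$ if $M>N$. For the second part: $X$ is a compact metric space, $T:X\to X$ is continuous, and uniquely ergodic means that $\mu$ is the only $T$-invariant Borel probability measure. Continuity of $f:X\to[0,\infty]$ is with respect to the metric $d(s,t)=|e^{-s}-e^{-t}|$ on $[0,\infty]$ (so that $[0,\infty]$ is compact). In the uniform convergence statement $f$ is replaced by $\hat f$, where $\hat f=f$ on $\{f<\infty\}$ and $\hat f=0$ on $\{f=\infty\}$. *)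

(* Defs.v *)
From HB Require Import structures.
From mathcomp Require Import all_boot all_order all_algebra.
From mathcomp Require Import all_classical all_reals all_analysis.
From mathcomp Require Import measurable_realfun.

Set Implicit Arguments.
Unset Strict Implicit.
Unset Printing Implicit Defensive.

Import Order.TTheory GRing.Theory Num.Theory.
Import numFieldNormedType.Exports.

Local Open Scope classical_set_scope.
Local Open Scope ring_scope.
Local Open Scope ereal_scope.

HB.mixin Record isBorel (d : measure_display) (K : numDomainType) X
    & Measurable d X & Metric K X := {
  measurable_borel : d.-measurable = <<s (@open X) >>
}.

#[short(type="borelMetricType")]
HB.structure Definition BorelMetric (d : measure_display) (K : numDomainType) :=
  {X of Measurable d X & Metric K X & isBorel d K X}.

Section dynamics.
Context {d : measure_display} {X : measurableType d} {R : realType}.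
Implicit Types (mu : probability X R) (T : X -> X) (f : X -> \bar R).

Definition invariant_measure mu T :=
  forall A, measurable A -> mu (T @^-1` A) = mu A.

Definition ergodic mu T :=
  forall A, measurable A -> T @^-1` A = A -> mu A = 0 \/ mu A = 1.

Definition ergodic_system mu T :=
  [/\ measurable_fun [set: X] T, invariant_measure mu T & ergodic mu T].

(* Uniqueness is equality on measurable sets: the values of a measure on
   non-measurable sets are unconstrained. *)
Definition uniquely_ergodic mu T :=
  invariant_measure mu T /\
  forall nu : probability X R, invariant_measure nu T ->
    forall A, measurable A -> nu A = mu A.

Definition nonintegrable_observable mu f :=
  [/\ forall x, 0 <= f x, measurable_fun [set: X] f,
      \int[mu]_x f x = +oo & mu (f @^-1` [set +oo]) = 0].

End dynamics.

Section trimmed_sums.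
Context {X : Type} {R : realType}.
Implicit Types (T : X -> X) (f : X -> \bar R) (k : nat -> nat) (b : nat -> R).

(* The k-subsets A of 'I_N stand for the indices n_1 < ... < n_k.  If f takes
   the value +oo along the first N points of the orbit, the result is that of
   the conventions of \bar R (+oo - +oo = -oo); for an invariant mu with
   mu (f = +oo) = 0 this only concerns a null set of x. *)
Definition trimmed_sum T f (N k : nat) (x : X) : \bar R :=
  if (k <= N)%N then
    \sum_(n < N) f (iter n T x) -
    \big[maxe/-oo]_(A : {set 'I_N} | #|A| == k) \sum_(n in A) f (iter n T x)
  else 0.

Definition hat f (x : X) : \bar R := if f x == +oo then 0 else f x.

Definition normalized_trimmed_sum T f k b (N : nat) (x : X) : \bar R :=
  trimmed_sum T f N (k N) x * ((b N)^-1)%:E.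

Definition admissible_trimming k b :=
  ((fun N => (k N)%:R : R) =o_\oo (fun N => N%:R : R)) /\
  forall N, (0 < b N)%R.

End trimmed_sums.

Section topology.
Context {d : measure_display} {R : realType} {X : borelMetricType d R}.

Definition regular_measure (mu : probability X R) :=
  forall A, measurable A ->
    mu A = ereal_inf [set mu U | U in [set U | open U /\ A `<=` U]] /\
    mu A = ereal_sup [set mu K | K in [set K | compact K /\ K `<=` A]].

(* The distance |e^{-s} - e^{-t}| on [0, +oo], where e^{-oo} = 0. *)
Definition exp_dist (s t : \bar R) : R :=
  `| fine (expeR (- s)) - fine (expeR (- t)) |%R.

Definition exp_dist_continuous (f : X -> \bar R) :=
  forall x (e : R), (0 < e)%R -> \forall y \near x, (exp_dist (f x) (f y) < e)%R.

End topology.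

(* Main.v *)
Require Import Defs.
From HB Require Import structures.
From mathcomp Require Import all_boot all_order all_algebra.
From mathcomp Require Import all_classical all_reals all_analysis.
From mathcomp Require Import measurable_realfun.
From mathcomp Require Import ring lra.

(** Trim with respect to a level [s] of the observable.  If [k] is slightly larger
    than the number of times [n < N] with [f (T^n x) > s], then [S_N^k (hat f)]
    is close to the Birkhoff sum of [f] cut off at [s]; the error is at most [s]
    for each removal too many.  By the ergodic theorem that number of times is
    about [N * mu (f > s)], and the Birkhoff sum is about [N * D] with
    [D = \int_(f <= s) f].  So for fixed [s] the ratio of [S_N^k] to [N * D] is
    eventually within [O(1 / D)] of [1], with [k / N] close to [mu (f > s)].
    Nonintegrability makes [D] as large as desired, finiteness almost everywhere
    makes [mu (f > s)] as small as desired, and letting [s] grow slowly with [N]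
    proves both parts.

    For the second part the cutoff must be continuous in order that the ergodic
    averages converge uniformly.  Hence everything is expressed through the
    truncations [trunc t = min f t]: the indicator of [f > s] is replaced by
    [tail_weight s = trunc (s + 1) - trunc s], and [D] by the integral of
    [trunc s - s * tail_weight s], which still tends to infinity with [s].
    A trimmed sum is bounded above by removing fractions [w] of the terms of
    total weight at most [k] ([trimmed_sum_le_weights]) and below by truncation
    ([trimmed_sum_ge_truncated]).  With the weights [tail_weight s] both bounds
    are linear in Birkhoff sums of truncations, and they differ by a constant
    times [N] ([trimmed_sum_estimate]).  Replacing [f] by [hat f] costs [s] for
    each visit to [f = +oo], and these visits are counted by [tail_weight r] for a
    much larger level [r].

    Two ergodic theorems for bounded functions feed this estimate.  Almost sure
    convergence ([pointwise_ergodic]) comes from the recursion for the maxima of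
    the Birkhoff sums; by Borel-Cantelli the times from which the scheme of level
    [s] works can be chosen independently of the point, up to finitely many levels
    ([eventual_to_uniform]).  Uniform convergence
    ([uniquely_ergodic_continuous]) is reduced to closed sets, where it says that
    the frequency of visits to [K] is at most [mu K + e] for all large [N],
    uniformly in the starting point ([uniquely_ergodic_closed]).  Otherwise an
    ultrafilter limit of visit frequencies would be an invariant finitely additive
    probability [m] with [m K > mu K].  Regularizing [m] from inside by closed
    sets and then from outside by open sets yields an invariant Borel probability
    that is at least [m] on closed sets, and therefore different from [mu]. *)

Set Implicit Arguments.
Unset Strict Implicit.
Unset Printing Implicit Defensive.

Import Order.TTheory GRing.Theory Num.Theory.
Import numFieldNormedType.Exports.

Local Open Scope classical_set_scope.
Local Open Scope ring_scope.
Local Open Scope ereal_scope.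

(** * Regularizing a finitely additive probability *)

Lemma closed_measurable (d : measure_display) (R : realType)
  (X : borelMetricType d R) (K : set X) : closed K -> measurable K.
Proof.
move=> cK; rewrite -(setCK K); apply: measurableC.
rewrite (@measurable_borel d R X).
by apply: sub_sigma_algebra; exact: closed_openC.
Qed.

Section regularization.
Context {d : measure_display} {R : realType} {X : borelMetricType d R}.
Hypothesis cptX : compact [set: X].

(** For closed subsets of an open set, the erosions play the role of a compact
    exhaustion: they are closed and increase to the set. *)
Definition erosion (n : nat) (U : set X) : set X :=
  [set x | ball x (n.+1%:R^-1)%R `<=` U].

Lemma sub_erosion n U : erosion n U `<=` U.
Proof. by move=> x; apply; exact: ballxx. Qed.

Lemma closed_erosion n U : closed (erosion n U).
Proof.
move=> x clx y; rewrite ballEmdist /= => xy.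
have e0 : (0 < n.+1%:R^-1 - mdist x y)%R by rewrite subr_gt0.
have [z []] := clx (ball x (n.+1%:R^-1 - mdist x y)%R) (nbhsx_ballx _ _ e0).
move=> zE; rewrite ballEmdist /= ltrBrDr => xz.
apply: zE; rewrite ballEmdist /=.
apply: le_lt_trans xz; rewrite addrC [mdist x z]metric_sym addrC.
exact: metric_triangle.
Qed.

(** This is where compactness enters: the sets [\bigcup_(i < n) erosion n (U i)]
    increase with [n], and every point of [K] has a neighbourhood inside one of
    them, so a single [n] serves all of [K].  The closed pieces are what makes
    the inner content below countably subadditive. *)
Lemma closed_sub_bigcup_erosion K (U : (set X)^nat) :
  closed K -> (forall i, open (U i)) -> K `<=` \bigcup_i U i ->
  exists n, K `<=` \big[setU/set0]_(i < n) erosion n (U i).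
Proof.
move=> clK oU KU.
have cK : compact K by exact: (subclosed_compact clK cptX).
have /compact_near_coveringP cov := cK.
have [N _ HN] : \forall n \near \oo,
    K `<=` (fun x => (\big[setU/set0]_(i < n) erosion n (U i)) x).
  apply: (cov nat \oo (fun n x => (\big[setU/set0]_(i < n) erosion n (U i)) x)).
  move=> x /KU[i _ Uix].
  have /nbhs_ballP[e /= e0 xe] : nbhs x (U i).
    by move: (oU i); rewrite openE => /(_ _ Uix).
  have e20 : (0 < e / 2)%R by rewrite divr_gt0.
  near=> x' n.
  rewrite -(bigcup_mkord n (fun i => erosion n (U i))); exists i => /=.
    by near: n; exact: nbhs_infty_gt.
  move=> y x'y; apply: xe.
  have -> : e = (e / 2 + e / 2)%R by rewrite -splitr.
  apply: (@ball_triangle _ _ x').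
    by near: x'; apply: nbhsx_ballx; rewrite divr_gt0.
  apply: le_ball x'y.
  by rewrite ltW//; near: n; exact: near_infty_natSinv_lt (PosNum e20).
by exists N; apply: HN => /=.
Unshelve. all: by end_near. Qed.

Variable m : set X -> R.
Hypothesis m_ge0 : forall A, (0 <= m A)%R.
Hypothesis mU : forall A B, A `&` B = set0 -> m (A `|` B) = (m A + m B)%R.
Hypothesis m_setT : m setT = 1%R.

Let m0 : m set0 = 0%R.
Proof.
have := mU (set0I (@set0 X)); rewrite setU0 => /eqP.
by rewrite -subr_eq0 opprD addNKr oppr_eq0 => /eqP.
Qed.

Let m_le A B : A `<=` B -> (m A <= m B)%R.
Proof.
move=> AB; rewrite -(setDUK AB) mU ?lerDl//.
by rewrite setDE setICA setICr setI0.
Qed.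

Let m_leU A B : (m (A `|` B) <= m A + m B)%R.
Proof.
rewrite -(setDUK (@subsetUl _ A B)) mU; last first.
  by rewrite setDE setICA setICr setI0.
by rewrite lerD2l m_le// => x [[]].
Qed.

Let m_le_sum n (F : (set X)^nat) :
  (m (\big[setU/set0]_(i < n) F i) <= \sum_(i < n) m (F i))%R.
Proof.
elim: n => [|n ih]; first by rewrite !big_ord0 m0.
rewrite !big_ord_recr /=; apply: (le_trans (m_leU _ _)).
by rewrite lerD2r.
Qed.

(** The set function [m] need not be countably additive.  Reading it off closed
    sets from inside, and then off open sets from outside, produces the Radon
    measure that the functional [m] defines on continuous functions; working
    with sets avoids the representation theorem. *)
Definition inner_content (U : set X) : \bar R :=
  ereal_sup [set (m K)%:E | K in [set K | closed K /\ K `<=` U]].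

Definition outer_regularization (A : set X) : \bar R :=
  ereal_inf [set inner_content U | U in [set U | open U /\ A `<=` U]].

Local Notation lam := inner_content.
Local Notation nu := outer_regularization.

Lemma le_inner_content K U : closed K -> K `<=` U -> (m K)%:E <= lam U.
Proof. by move=> cK KU; apply: ereal_sup_ubound; exists K. Qed.

Let lam_mono U V : U `<=` V -> lam U <= lam V.
Proof.
move=> UV; apply: ge_ereal_sup => _ [K [cK KU] <-].
exact: le_inner_content (subset_trans KU UV).
Qed.

Let lam_ge0 U : 0 <= lam U.
Proof.
by have := le_inner_content closed0 (@sub0set _ U); rewrite m0.
Qed.

Lemma inner_contentT : lam setT = 1.
Proof.
apply/eqP; rewrite eq_le; apply/andP; split.
  apply: ge_ereal_sup => _ [K [cK KU] <-].
  by rewrite -[leRHS]/(1%R%:E) lee_fin -m_setT m_le.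
by rewrite -[leLHS]/(1%R%:E) -m_setT; exact: le_inner_content.
Qed.

Lemma outer_regularization_open U : open U -> nu U = lam U.
Proof.
move=> oU; apply/eqP; rewrite eq_le; apply/andP; split.
  by apply: ereal_inf_lbound; exists U => //; split.
by apply: le_ereal_inf_tmp => _ [V [_ UV] <-]; exact: lam_mono.
Qed.

(** Mass may only be gained on closed sets, as in the portmanteau theorem: mass
    of [m] that approaches [K] from outside ends up on [K]. *)
Lemma outer_regularization_closed K : closed K -> (m K)%:E <= nu K.
Proof.
move=> cK; apply: le_ereal_inf_tmp => _ [V [_ UV] <-].
exact: le_inner_content.
Qed.

Let nu_ge0 A : 0 <= nu A.
Proof. by apply: le_ereal_inf_tmp => _ [V [_ UV] <-]. Qed.

Let nu_mono : {homo nu : A B / A `<=` B >-> A <= B}.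
Proof.
move=> A B AB; apply: le_ereal_inf => _ [V [oV BV] <-].
by exists V => //; split=> //; exact: subset_trans BV.
Qed.

Let nu_fin A : nu A \is a fin_num.
Proof.
rewrite ge0_fin_numE//; apply: (@le_lt_trans _ _ (1%:E)); last exact: ltry.
by rewrite -inner_contentT -(outer_regularization_open openT) nu_mono.
Qed.

Let nu0 : nu set0 = 0.
Proof.
apply/eqP; rewrite eq_le nu_ge0 andbT outer_regularization_open; last first.
  exact: open0.
apply: ge_ereal_sup => _ [K [_ K0] <-].
by move: K0; rewrite subset0 => ->; rewrite m0.
Qed.

Let lam_sigma_subadditive (U : (set X)^nat) : (forall i, open (U i)) ->
  lam (\bigcup_i U i) <= \sum_(i <oo) lam (U i).
Proof.
move=> oU; apply: ge_ereal_sup => _ [K [cK KU] <-].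
have [n Kn] := closed_sub_bigcup_erosion cK oU KU.
apply: (@le_trans _ _ (\sum_(0 <= i < n) lam (U i))); last first.
  by apply: nneseries_lim_ge => *; exact: lam_ge0.
apply: (@le_trans _ _ (\sum_(i < n) m (erosion n (U i)))%R%:E).
  rewrite lee_fin; apply: le_trans (m_le Kn) _.
  exact: m_le_sum (fun i => erosion n (U i)).
rewrite -sumEFin big_mkord lee_sum// => i _.
by apply: le_inner_content; [exact: closed_erosion|exact: sub_erosion].
Qed.

Let nu_sigma_subadditive : sigma_subadditive nu.
Proof.
move=> F; apply/lee_addgt0Pr => e e0.
have e0' : (0 <= e)%R by exact: ltW.
have HV i : exists V, [/\ open V, F i `<=` V &
    lam V <= nu (F i) + (e / (2 ^ i.+1)%:R)%:E].
  have ei : (0 < e / (2 ^ i.+1)%:R)%R by rewrite divr_gt0// ltr0n expn_gt0.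
  have [_ [V [oV FV] <-] lV] := lb_ereal_inf_adherent ei (nu_fin (F i)).
  by exists V; split=> //; exact: ltW.
have {HV}[V HV] := choice HV.
have oV i : open (V i) by have [] := HV i.
apply: le_trans (epsilon_trick xpredT _ e0'); last by move=> n; exact: nu_ge0.
apply: (@le_trans _ _ (lam (\bigcup_i V i))).
  apply: ereal_inf_lbound; exists (\bigcup_i V i) => //.
  split; first exact: bigcup_open.
  by apply: subset_bigcup => i _; have [] := HV i.
apply: (le_trans (lam_sigma_subadditive oV)).
by apply: lee_nneseries => i _; [move=> *; exact: lam_ge0|have [] := HV i].
Qed.

HB.instance Definition _ :=
  isOuterMeasure.Build R X nu nu0 nu_ge0 nu_mono nu_sigma_subadditive.

(** Inside an open [V], first exhaust [V `&` U] by a closed [K], and then the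
    open set [V `\` K], which contains [V `\` U], by a closed [L]: the sets [K]
    and [L] are disjoint, so [m] adds up over them. *)
Lemma open_caratheodory U : open U -> nu.-caratheodory U.
Proof.
move=> oU; apply: le_caratheodory_measurable => A.
apply: le_ereal_inf_tmp => _ [V [oV AV] <-].
apply: (@le_trans _ _ (lam (V `&` U) + nu (V `&` ~` U))).
  apply: leeD; last by apply: nu_mono; exact: setSI.
  rewrite -outer_regularization_open; last exact: openI.
  by apply: nu_mono; exact: setSI.
rewrite -leeBrDr//; apply: ge_ereal_sup => _ [K [cK KVU] <-].
rewrite leeBrDr// addeC -leeBrDr//.
apply: (@le_trans _ _ (lam (V `\` K))).
  rewrite -outer_regularization_open; last first.
    by rewrite setDE; apply: openI => //; exact: closed_openC.
  by apply: nu_mono => x [Vx nUx]; split=> // /KVU[].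
apply: ge_ereal_sup => _ [L [cL LVK] <-].
rewrite leeBrDr//.
rewrite -EFinD -mU; last first.
  by rewrite -subset0 => x [/LVK[_ nKx] /nKx].
apply: le_inner_content; first exact: closedU.
by move=> x [/LVK[]//|/KVU[]].
Qed.

Let measurable_caratheodory A : measurable A -> nu.-caratheodory A.
Proof.
rewrite (@measurable_borel d R X).
apply: smallest_sub; last exact: open_caratheodory.
split; first exact: caratheodory_measurable_set0.
  by move=> B cB; rewrite setTD; exact: caratheodory_measurable_setC.
exact: caratheodory_measurable_bigcup.
Qed.

Let nu_semi_sigma_additive : semi_sigma_additive (nu : set X -> \bar R).
Proof.
move=> F mF tF mUF.
apply: (@caratheodory_measure_sigma_additive R X nu) => //.
  by move=> i; exact: measurable_caratheodory.
exact: measurable_caratheodory.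
Qed.

HB.instance Definition _ :=
  isMeasure.Build d X R nu nu0 nu_ge0 nu_semi_sigma_additive.

Let nu_setT : nu setT = 1.
Proof.
by rewrite outer_regularization_open; [exact: inner_contentT|exact: openT].
Qed.

HB.instance Definition _ := Measure_isProbability.Build d X R nu nu_setT.

Lemma regularization_probability : exists nu : probability X R,
  (forall K, closed K -> (m K)%:E <= nu K) /\
  (forall U, open U -> nu U = inner_content U).
Proof.
exists nu; split; first exact: outer_regularization_closed.
exact: outer_regularization_open.
Qed.

(** Preimages of closed sets under [T] are closed, and so are images, because
    they are compact in a Hausdorff space. *)
Lemma inner_content_preimage (T : X -> X) U : continuous T ->
  (forall A, m (T @^-1` A) = m A) ->
  inner_content (T @^-1` U) = inner_content U.
Proof.
move=> cT minv; apply/eqP; rewrite eq_le; apply/andP; split.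
  apply: ge_ereal_sup => _ [L [cL LU] <-].
  apply: (@le_trans _ _ (m (T @` L))%:E).
    by rewrite lee_fin -(minv (T @` L)); apply: m_le => x Lx; exists x.
  apply: le_inner_content; last by move=> _ [x Lx <-]; exact: LU.
  apply: compact_closed; first exact: metric_hausdorff.
  apply: continuous_compact; first by apply: continuous_subspaceT.
  exact: (subclosed_compact cL cptX).
apply: ge_ereal_sup => _ [L [cL LU] <-]; rewrite -minv.
apply: le_inner_content; last exact: preimage_subset.
by apply: closed_comp => // x _; exact: cT.
Qed.

(** The regularization of an invariant finitely additive probability is an
    invariant Borel probability, so unique ergodicity identifies it with [mu]. *)
Lemma finitely_additive_le_uniquely_ergodic
    (mu : probability X R) (T : X -> X) :
  measurable_fun setT T -> continuous T -> uniquely_ergodic mu T ->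
  (forall A, m (T @^-1` A) = m A) ->
  forall K, closed K -> (m K)%:E <= mu K.
Proof.
move=> mT cT [_ uniq] minv K cK.
have [nu [nuK nuU]] := regularization_probability.
have mK := closed_measurable cK.
rewrite -(uniq nu _ K mK); first exact: nuK.
move=> A mA; apply/esym.
(* Open sets are stable under intersection and generate the Borel sets. *)
have := @measure_unique d R X (@open X) (fun=> setT) (@measurable_borel d R X)
  (@openI X) (fun=> openT) _ nu (pushforward nu T).
move=> ->//.
- by rewrite bigcup_const//; exists 0%N.
- move=> U oU; transitivity (inner_content U); first exact: nuU.
  have oTU : open (T @^-1` U) by apply: open_comp => // x _; exact: cT.
  transitivity (inner_content (T @^-1` U)); last exact/esym/nuU.
  by rewrite inner_content_preimage.
- by move=> _; rewrite (_ : _ setT = 1) ?ltry//; exact: probability_setT.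
Qed.

End regularization.
(** * Orbit means *)

Section orbit_means.
Context {R : realType} {X : Type}.
Implicit Types (T : X -> X) (h : X -> R).

Definition orbit_mean T (N : nat) h (x : X) : R :=
  (N%:R^-1 * \sum_(n < N) h (iter n T x))%R.

Lemma orbit_meanD T N h1 h2 x :
  orbit_mean T N (fun y => h1 y + h2 y)%R x =
  (orbit_mean T N h1 x + orbit_mean T N h2 x)%R.
Proof. by rewrite /orbit_mean big_split mulrDr. Qed.

Lemma orbit_meanZ T N h (c : R) x :
  orbit_mean T N (fun y => c * h y)%R x = (c * orbit_mean T N h x)%R.
Proof. by rewrite /orbit_mean -mulr_sumr mulrCA. Qed.

Lemma orbit_mean_sum T N n (h : 'I_n -> X -> R) x :
  orbit_mean T N (fun y => \sum_(i < n) h i y)%R x =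
  (\sum_(i < n) orbit_mean T N (h i) x)%R.
Proof. by rewrite /orbit_mean exchange_big /= mulr_sumr. Qed.

Lemma orbit_mean_cst T N (c : R) x : (0 < N)%N ->
  orbit_mean T N (fun=> c) x = c.
Proof.
move=> N0; rewrite /orbit_mean sumr_const card_ord -[(c *+ N)%R]mulr_natl.
rewrite mulrA mulVf ?mul1r//.
by rewrite pnatr_eq0 -lt0n.
Qed.

Lemma le_orbit_mean T N h1 h2 x : (forall y, h1 y <= h2 y)%R ->
  (orbit_mean T N h1 x <= orbit_mean T N h2 x)%R.
Proof.
by move=> h12; rewrite /orbit_mean ler_wpM2l ?invr_ge0// ler_sum.
Qed.

Lemma orbit_mean_ge0 T N h x : (forall y, 0 <= h y)%R ->
  (0 <= orbit_mean T N h x)%R.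
Proof. by move=> h0; rewrite mulr_ge0 ?invr_ge0// sumr_ge0. Qed.

Lemma orbit_mean_shift T N h (c : R) x : (forall y, 0 <= h y <= c)%R ->
  (`| orbit_mean T N (h \o T) x - orbit_mean T N h x | <= c * N%:R^-1)%R.
Proof.
move=> h01; rewrite /orbit_mean -mulrBr -sumrB.
rewrite (eq_bigr (fun n : 'I_N => h (iter n.+1 T x) - h (iter n T x))%R)//.
rewrite -(big_mkord xpredT (fun n => h (iter n.+1 T x) - h (iter n T x))%R).
rewrite telescope_sumr// normrM ger0_norm ?invr_ge0// mulrC.
rewrite ler_wpM2r ?invr_ge0//.
have /andP[a0 a1] := h01 (iter N T x); have /andP[b0 b1] := h01 (iter 0 T x).
rewrite ler_norml; apply/andP; split; lra.
Qed.

End orbit_means.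

(** * Visits to closed sets in a uniquely ergodic system *)

Section ultralimits.
Context {R : realType} (G : set_system nat) (ultraG : UltraFilter G).

(** A cluster point exists by compactness of [[0, 1]], and every cluster point
    of an ultrafilter is a limit. *)
Lemma bounded_ultra_cvg (u : nat -> R) :
  (forall n, 0 <= u n <= 1)%R -> cvg (u @ G).
Proof.
move=> u01.
have cpt := @segment_compact R 0%R 1%R.
have [|p [_ pc]] := cpt (u @ G) _.
  by apply: (@filterE _ G) => n /=; rewrite in_itv /= u01.
apply/cvg_ex; exists p => V Vp.
have [//|GV] := in_ultra_setVsetC (u @^-1` V) ultraG.
by have [q []] := pc (~` V) V GV Vp.
Qed.

End ultralimits.

Section unique_ergodicity.
Context {d : measure_display} {R : realType} {X : borelMetricType d R}.

(** The uniform upper bound of the portmanteau theorem.  If it failed, there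
    would be points [x N], for infinitely many [N], whose first [N] iterates
    visit [K] too often.  Along an ultrafilter that contains these [N], the visit
    frequencies of [x N] converge on every set at once; their limit is a finitely
    additive invariant probability which exceeds [mu] on [K]. *)
Lemma uniquely_ergodic_closed (mu : probability X R) (T : X -> X) (K : set X)
    (e : R) :
  compact [set: X] -> measurable_fun setT T -> continuous T ->
  uniquely_ergodic mu T -> closed K -> (0 < e)%R ->
  \forall N \near \oo, forall x,
    (orbit_mean T N \1_K x <= fine (mu K) + e)%R.
Proof.
move=> cptX mT cT uniq cK e0; apply: contrapT => nK.
pose bad := [set N | exists x, fine (mu K) + e < orbit_mean T N \1_K x]%R.
have [x xP] : exists x : nat -> X, forall N, bad N ->
    (fine (mu K) + e < orbit_mean T N \1_K (x N))%R.
  suff H : forall N, exists y, bad N ->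
    (fine (mu K) + e < orbit_mean T N \1_K y)%R.
    by have [f fP] := choice H; exists f.
  move=> N; have [[y Ny]|nN] := pselect (bad N); first by exists y.
  by exists point => /nN.
have bad_proper : ProperFilter (within bad \oo).
  split; [|exact: within_filter] => bad0.
  apply: nK; move: bad0; rewrite /within /=; apply: filterS => N badN y.
  by rewrite leNgt; apply/negP => ?; apply: badN; exists y.
have [G [ultraG badG]] := ultraFilterLemma bad_proper.
have ooG : \oo `<=` G.
  by move=> A ooA; apply: badG; rewrite /within /=; apply: filterS ooA.
have Gbad : G bad by apply: badG; rewrite /within /=; exact: filterE.
pose u A N : R := orbit_mean T N \1_A (x N).
have u01 A N : (0 <= u A N <= 1)%R.
  apply/andP; split; first by apply: orbit_mean_ge0 => y; rewrite indicE.
  case: N => [|N]; first by rewrite /u /orbit_mean big_ord0 mulr0.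
  rewrite -(@orbit_mean_cst R X T N.+1 1%R (x N.+1))//.
  by apply: le_orbit_mean => y; rewrite indicE; case: (_ \in _).
have cu A : cvg (u A @ G) by exact: (bounded_ultra_cvg ultraG).
pose m A := (lim (u A @ G))%R.
have m_ge0 A : (0 <= m A)%R.
  by apply: limr_ge => //; apply: filterE => N; have /andP[] := u01 A N.
have mU A B : A `&` B = set0 -> m (A `|` B) = (m A + m B)%R.
  move=> AB; apply: cvg_lim => //.
  rewrite (_ : u (A `|` B) = (fun N => u A N + u B N)%R); first exact: cvgD.
  apply/funext => N; rewrite /u -orbit_meanD; congr (orbit_mean _ _ _ _).
  apply/funext => y; rewrite !indicE in_setU.
  case: (boolP (y \in A)) => yA; case: (boolP (y \in B)) => yB;
    rewrite /= ?addr0 ?add0r//.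
  have : (A `&` B) y by split; exact/set_mem.
  by rewrite AB.
have m_setT : m setT = 1%R.
  apply: cvg_lim => //; apply: cvg_near_cst.
  apply: ooG; exists 1%N => // N /= N0.
  rewrite /u indicT; exact: orbit_mean_cst.
have minv A : m (T @^-1` A) = m A.
  have : (u (T @^-1` A) N - u A N)%R @[N --> G] --> (m (T @^-1` A) - m A)%R.
    by apply: cvgB.
  have : (u (T @^-1` A) N - u A N)%R @[N --> G] --> (0 : R)%R.
    apply/norm_cvg0P.
    apply: (@squeeze_cvgr _ _ _ _ (fun=> 0%R) (fun N => N%:R^-1)%R).
    - apply: filterE => N; rewrite normr_ge0/=.
      have A01 y : (0 <= (\1_A y : R) <= 1)%R.
        by rewrite indicE; case: (_ \in _); rewrite ?lexx ?ler01.
      by have := orbit_mean_shift T N (x N) A01; rewrite [leRHS]mul1r.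
    - exact: cvg_cst.
    - have : (N%:R^-1 : R)%R @[N --> \oo] --> 0%R.
        apply/gtr0_cvgV0; last exact: cvgr_idn.
        by exists 1%N => // N /=; rewrite ltr0n.
      by move=> invN V /invN; exact: ooG.
  move=> c0 c1; apply/eqP; rewrite -subr_eq0; apply/eqP.
  exact: (cvg_unique _ c1 c0).
have := finitely_additive_le_uniquely_ergodic cptX m_ge0 mU m_setT
  mT cT uniq minv cK.
apply/negP; rewrite -ltNge.
have mK := closed_measurable cK.
rewrite -(@fineK _ (mu K)) ?fin_num_measure// lte_fin.
apply: (@lt_le_trans _ _ (fine (mu K) + e)%R); first by rewrite ltrDl.
apply: limr_ge => //; apply: filterS Gbad => N /xP; exact: ltW.
Qed.

End unique_ergodicity.
(** * The pointwise ergodic theorem for bounded functions *)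

Section bounded_functions.
Context {d : measure_display} {X : measurableType d} {R : realType}.
Variable mu : probability X R.
Implicit Types (h : X -> R) (T : X -> X).

Lemma bounded_integrable h (C : R) : measurable_fun setT h ->
  (forall x, `|h x| <= C)%R -> mu.-integrable setT (EFin \o h).
Proof.
move=> mh hC; apply: measurable_bounded_integrable => //.
  by rewrite (_ : _ setT = 1) ?ltry//; exact: probability_setT.
exists C; split; first by rewrite num_real.
by move=> M CM x _ /=; exact: le_trans (hC x) (ltW CM).
Qed.

Lemma Rintegral_comp_invariant T h (C : R) : measurable_fun setT T ->
  invariant_measure mu T -> measurable_fun setT h ->
  (forall x, `|h x| <= C)%R ->
  (\int[mu]_x h (T x) = \int[mu]_x h x)%R.
Proof.
move=> mT inv mh hC; congr fine.
have inth := bounded_integrable mh hC.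
transitivity (\int[pushforward mu T]_x (h x)%:E).
  rewrite integral_pushforward//; last first.
    apply: (@bounded_integrable (h \o T) C) => [|x]; last exact: hC.
    exact: measurableT_comp.
  exact/measurable_EFinP.
by apply: eq_measure_integral => A mA _; exact: inv.
Qed.

End bounded_functions.

Section pointwise_ergodic_theorem.
Context {d : measure_display} {X : measurableType d} {R : realType}.
Variables (mu : probability X R) (T : X -> X).
Hypothesis ergT : ergodic_system mu T.
Implicit Types h g : X -> R.

Let mT : measurable_fun setT T. Proof. by have [] := ergT. Qed.
Let invT : invariant_measure mu T. Proof. by have [] := ergT. Qed.

(** The maximum of the Birkhoff sums of at most [n] terms, in the form of the
    recursion behind [birkhoff_sum_bounded_above]. *)
Fixpoint max_birkhoff_sum g (n : nat) (x : X) : R :=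
  if n is n'.+1 then Num.max 0%R (g x + max_birkhoff_sum g n' (T x))%R else 0%R.

Local Notation M := max_birkhoff_sum.

Lemma max_birkhoff_sum_ge0 g n x : (0 <= M g n x)%R.
Proof. by case: n => //= n; rewrite le_max lexx. Qed.

Lemma max_birkhoff_sum_le g n x : (M g n x <= M g n.+1 x)%R.
Proof.
elim: n x => [x|n ih x]; first exact: max_birkhoff_sum_ge0.
by rewrite /= le_max2// lerD2l; exact: ih.
Qed.

Lemma birkhoff_sum_le_max g n x : (\sum_(i < n) g (iter i T x) <= M g n x)%R.
Proof.
elim: n x => [x|n ih x]; first by rewrite big_ord0.
rewrite big_ord_recl /= le_max; apply/orP; right; rewrite lerD2l.
by under eq_bigr do rewrite -iterS iterSr; exact: ih.
Qed.

Lemma measurable_max_birkhoff_sum g n : measurable_fun setT g ->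
  measurable_fun setT (M g n).
Proof.
move=> mg; elim: n => [|n ih]; first exact: measurable_cst.
apply: measurable_maxr; first exact: measurable_cst.
by apply: measurable_funD => //; exact: measurableT_comp.
Qed.

Lemma max_birkhoff_sum_bounded g (C : R) n x : (forall y, `|g y| <= C)%R ->
  (`|M g n x| <= C *+ n)%R.
Proof.
move=> gC; rewrite ger0_norm ?max_birkhoff_sum_ge0//.
have C0 : (0 <= C)%R by exact: le_trans (gC x).
elim: n x => [x|n ih x]; first by rewrite mulr0n.
rewrite /= ge_max mulrn_wge0//= mulrS lerD//.
by apply: le_trans (gC x); exact: ler_norm.
Qed.

(** The maxima [M n] satisfy [M n.+1 - M n \o T = max (- M n \o T) g].  The left
    side has nonnegative integral, by invariance and monotonicity in [n].  On the
    invariant set where [M n] tends to infinity, the right side is eventually [g].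
    If that set had full measure, dominated convergence would give
    [\int g >= 0]; by ergodicity it is therefore null. *)
Lemma birkhoff_sum_bounded_above g (C : R) : measurable_fun setT g ->
  (forall y, `|g y| <= C)%R -> (\int[mu]_x g x < 0)%R ->
  {ae mu, forall x, exists B : nat, forall N,
    (\sum_(n < N) g (iter n T x) <= B%:R)%R}.
Proof.
move=> mg gC gneg.
pose E := \bigcap_(B : nat) \bigcup_n [set x | B%:R < M g n x]%R.
have mE : measurable E.
  apply: bigcapT_measurable => B; apply: bigcupT_measurable => n.
  rewrite (_ : mkset _ = M g n @^-1` `]B%:R, +oo[%classic).
    by rewrite -[X in measurable X]setTI; apply: measurable_max_birkhoff_sum.
  by apply/seteqP; split => x /=; rewrite in_itv /= andbT.
have C0 : (0 <= C)%R by exact: le_trans (gC point).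
have TE : T @^-1` E = E.
  apply/seteqP; split => x Ex B _.
    have [n _ /= nB] := Ex (B + Num.truncn C).+1 I.
    exists n.+1 => //=; rewrite lt_max; apply/orP; right.
    have := gC x; rewrite ler_norml => /andP[gC1 _].
    have := truncnS_gt C; move: nB; rewrite -addnS natrD.
    lra.
  have [n _ /= nB] := Ex (B + Num.truncn C).+1 I.
  case: n nB => [|n] /= nB.
    by move: nB; rewrite ltNge ler0n.
  exists n => //=; move: nB; rewrite lt_max ltNge ler0n /=.
  have := gC x; rewrite ler_norml => /andP[_ gC1].
  have := truncnS_gt C; rewrite -addnS natrD.
  lra.
have [E0|E1] := (let: And3 _ _ erg := ergT in erg E mE TE).
  exists E; split => // x /= nb B _.
  apply: contrapT => nE; apply: nb; exists B => N.
  apply: le_trans (birkhoff_sum_le_max _ _ _) _.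
  by rewrite leNgt; apply/negP => BM; apply: nE; exists N.
exfalso; move: gneg; apply/negP; rewrite -leNgt.
pose D n x := (M g n.+1 x - M g n (T x))%R.
have DE n x : D n x = Num.max (- M g n (T x))%R (g x).
  by rewrite /D /= addr_maxl add0r addrK.
have mM n : measurable_fun setT (M g n) by exact: measurable_max_birkhoff_sum.
have mD n : measurable_fun setT (D n).
  by apply: measurable_funB => //; exact: measurableT_comp.
have MC n x : (`|M g n x| <= C *+ n)%R by exact: max_birkhoff_sum_bounded.
have intD n : (0 <= \int[mu]_x D n x)%R.
  rewrite RintegralB//; last 2 first.
    exact: bounded_integrable (MC n.+1).
    apply: (@bounded_integrable _ _ _ mu (M g n \o T) (C *+ n)) => [|x].
      exact: measurableT_comp.
    exact: MC.
  rewrite (@Rintegral_comp_invariant _ _ _ _ _ (M g n) (C *+ n))// subr_ge0.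
  apply: le_Rintegral => //; last by move=> x _; exact: max_birkhoff_sum_le.
    exact: bounded_integrable (MC n).
  exact: bounded_integrable (MC n.+1).
have DC n x : (`|D n x| <= C)%R.
  have M0 := max_birkhoff_sum_ge0 g n (T x).
  have := gC x; rewrite DE !ler_norml => /andP[g1 g2].
  by rewrite le_max g1 orbT ge_max g2 andbT; lra.
have aeE : {ae mu, forall x, E x}.
  exists (~` E); split => //; first exact: measurableC.
  by rewrite probability_setC// E1 subee.
have cvgD x : E x -> (D n x)%:E @[n --> \oo] --> (g x)%:E.
  move=> Ex; apply: cvg_near_cst.
  have [B CB] : exists B : nat, (C <= B%:R)%R.
    by exists (Num.truncn C).+1; apply/ltW/truncnS_gt.
  have ETx : E (T x) by rewrite -[E (T x)]/((T @^-1` E) x) TE.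
  have [n _ /= nB] := ETx B I.
  exists n => // k /= nk; congr _%:E.
  have nkM : {homo M g ^~ (T x) : i j / (i <= j)%N >-> (i <= j)%R}.
    by apply: homo_leq => // [|i];
      [exact: le_trans|exact: max_birkhoff_sum_le].
  have Mk : (B%:R < M g k (T x))%R by apply: lt_le_trans (nkM _ _ nk).
  rewrite DE; apply/max_idPr.
  by have := gC x; rewrite ler_norml => /andP[g1 _]; lra.
have [_ _ lim_int] : [/\ mu.-integrable setT (EFin \o g),
    [sequence \int[mu]_x `|(D n x)%:E - (g x)%:E|]_n @ \oo --> 0 &
    [sequence \int[mu]_x (D n x)%:E]_n @ \oo --> \int[mu]_x (g x)%:E].
  apply: (@dominated_convergence _ X R mu setT measurableT
    (fun n x => (D n x)%:E) (EFin \o g) (cst C%:E)).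
  - by move=> n; exact/measurable_EFinP.
  - exact/measurable_EFinP.
  - by apply: filterS aeE => x Ex _; exact: cvgD.
  - apply: (@bounded_integrable _ _ _ mu (cst C) C) => [|x].
      exact: measurable_cst.
    by rewrite /= ger0_norm.
  - by apply: aeW => x n _; rewrite lee_fin.
rewrite fine_ge0// -(cvg_lim _ lim_int)//; apply: lime_ge.
  by apply/cvg_ex; eexists; exact: lim_int.
apply: nearW => n /=; have := intD n; rewrite /Rintegral.
rewrite -lee_fin fineK//.
apply: integrable_fin_num => //; exact: bounded_integrable (DC n).
Qed.

(** Apply the previous lemma to [h - I - 1 / k.+1] and to [I - 1 / k.+1 - h],
    whose integrals are negative: their Birkhoff sums are bounded above, hence
    negligible after division by [N]. *)
Lemma pointwise_ergodic h (C : R) : measurable_fun setT h ->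
  (forall y, `|h y| <= C)%R ->
  {ae mu, forall x, forall e : R, (0 < e)%R -> \forall N \near \oo,
    (`|orbit_mean T N h x - \int[mu]_y h y| <= e)%R}.
Proof.
move=> mh hC; set I := (\int[mu]_y h y)%R.
have C0 : (0 <= C)%R by exact: le_trans (hC point).
have inth := bounded_integrable mu mh hC.
have icst c : mu.-integrable setT (EFin \o (fun=> c)).
  by apply: (@bounded_integrable _ _ _ mu _ `|c|%R) => [|x];
    [exact: measurable_cst|].
have Rcst c : (\int[mu]_y c = c :> R)%R.
  rewrite Rintegral_cst// (_ : _ setT = 1) ?mulr1//.
  exact: probability_setT.
have up k : {ae mu, forall x, exists B : nat, forall N,
    (\sum_(n < N) (h (iter n T x) - (I + k.+1%:R^-1)) <= B%:R)%R}.
  apply: (@birkhoff_sum_bounded_above (fun y => h y - (I + k.+1%:R^-1))%R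
    (C + `|I + k.+1%:R^-1|)%R).
  - by apply: measurable_funB => //; exact: measurable_cst.
  - by move=> y; apply: le_trans (ler_normB _ _) _; rewrite lerD2r.
  - by rewrite RintegralB// Rcst -/I opprD addrA subrr add0r oppr_lt0 invr_gt0.
have down k : {ae mu, forall x, exists B : nat, forall N,
    (\sum_(n < N) ((I - k.+1%:R^-1) - h (iter n T x)) <= B%:R)%R}.
  apply: (@birkhoff_sum_bounded_above (fun y => (I - k.+1%:R^-1) - h y)%R
    (`|I - k.+1%:R^-1| + C)%R).
  - by apply: measurable_funB => //; exact: measurable_cst.
  - by move=> y; apply: le_trans (ler_normB _ _) _; rewrite lerD2l.
  - by rewrite RintegralB// Rcst -/I addrAC subrr add0r oppr_lt0 invr_gt0.
apply: filterS2 (ae_foralln up) (ae_foralln down) => x upx downx e e0.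
have [k ke] : exists k : nat, (k.+1%:R^-1 < e / 2)%R.
  have [k _ /(_ k (leqnn k)) ke] :=
    near_infty_natSinv_lt (PosNum (divr_gt0 e0 (ltr0Sn R 1))).
  by exists k.
have [B HB] := upx k; have [B' HB'] := downx k.
near=> N.
have N0 : (0 < N%:R :> R)%R by rewrite ltr0n; near: N; exact: nbhs_infty_gt.
have NB : ((B + B')%:R <= e / 2 * N%:R)%R.
  rewrite -ler_pdivrMl ?divr_gt0//; near: N; exact: nbhs_infty_ger.
rewrite natrD in NB.
have Bp : (0 <= B%:R :> R)%R by []; have Bp' : (0 <= B'%:R :> R)%R by [].
have := HB N; have := HB' N; rewrite !sumrB !sumr_const !card_ord.
rewrite mulrnDl -(mulr_natr I N) -(mulr_natr k.+1%:R^-1%R N).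
rewrite /orbit_mean; set S := (\sum_(_ < _) _)%R => H1 H2.
have kN : (k.+1%:R^-1 * N%:R <= e / 2 * N%:R)%R by rewrite ler_pM2r// ltW.
have -> : (N%:R^-1 * S - I = (S - I * N%:R) / N%:R)%R.
  by rewrite mulrBl mulrC mulfK// gt_eqF.
rewrite normrM [`|N%:R^-1|%R]ger0_norm ?invr_ge0// ler_pdivrMr//.
rewrite [(e / 2 * _)%R]mulrAC in NB kN.
rewrite ler_norml; apply/andP; move: H1 H2 NB kN Bp Bp'.
move: (e * _)%R (I * _)%R (_^-1 * _)%R (B%:R)%R (B'%:R)%R => p q r b b' *.
split; lra.
Unshelve. all: by end_near. Qed.

End pointwise_ergodic_theorem.
(** * Uniform convergence of orbit means *)

Section uniform_ergodic_theorem.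
Context {d : measure_display} {R : realType} {X : borelMetricType d R}.
Variables (mu : probability X R) (T : X -> X).
Hypothesis cptX : compact [set: X].
Hypothesis mT : measurable_fun setT T.
Hypothesis cT : continuous T.
Hypothesis uniqT : uniquely_ergodic mu T.
Implicit Types h : X -> R.

Let layer h (del : R) (i : nat) : set X := [set y | i%:R * del <= h y]%R.

(** With [t i = min (h y) (i * del)], each increment [t i.+1 - t i] lies between
    [del] times the indicators of the layers [i.+1] and [i]; both bounds
    telescope. *)
Let layer_cake h (del : R) (Q : nat) y :
  (0 < del)%R -> (0 <= h y <= Q%:R * del)%R ->
  (\sum_(i < Q) del * \1_(layer h del i.+1) y <= h y <=
   del + \sum_(i < Q) del * \1_(layer h del i.+1) y)%R.
Proof.
move=> del0 /andP[h0 hQ].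
pose t i := Num.min (h y) (i%:R * del)%R.
have S i : (i.+1%:R * del = i%:R * del + del)%R by rewrite -natr1 mulrDl mul1r.
have t_le i : (t i <= t i.+1)%R.
  rewrite /t S; move: (_ * del)%R => a.
  by case: (leP (h y) a); case: (leP (h y) (a + del)%R) => *; lra.
have stepl i : (del * \1_(layer h del i.+1) y <= t i.+1 - t i)%R.
  rewrite indicE; have [|hi] := boolP (y \in layer h del i.+1).
    rewrite inE /layer /= /t S; move: (_ * del)%R => a.
    by case: (leP (h y) a); case: (leP (h y) (a + del)%R) => *; lra.
  by rewrite mulr0 subr_ge0 t_le.
have stepr i : (t i.+1 - t i <= del * \1_(layer h del i) y)%R.
  rewrite indicE; have [_|] := boolP (y \in layer h del i).
    rewrite mulr1 /t S; move: (_ * del)%R => a.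
    by case: (leP (h y) a); case: (leP (h y) (a + del)%R) => *; lra.
  rewrite notin_setE /layer /= => /negP; rewrite -ltNge => hi.
  move: hi; rewrite mulr0 /t S; move: (_ * del)%R => a.
  by case: (leP (h y) a); case: (leP (h y) (a + del)%R) => *; lra.
have tele n : (\sum_(i < n) (t i.+1 - t i) = t n)%R.
  rewrite -(big_mkord xpredT (fun i => t i.+1 - t i)%R) telescope_sumr//.
  by rewrite [t 0%N]/t mul0r (min_idPr h0) subr0.
apply/andP; split.
  apply: (@le_trans _ _ (t Q)); last by rewrite /t ge_min lexx.
  by rewrite -tele; apply: ler_sum.
have -> : h y = t Q by rewrite /t; apply/esym/min_idPl.
rewrite -tele; apply: (@le_trans _ _ (\sum_(i < Q.+1) (t i.+1 - t i))%R).
  by rewrite big_ord_recr /= lerDl subr_ge0 t_le.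
rewrite big_ord_recl /=; apply: lerD; last by apply: ler_sum.
apply: le_trans (stepr 0%N) _; rewrite indicE.
by case: (_ \in _); rewrite ?mulr1// mulr0 ltW.
Qed.

(** A bounded upper semicontinuous function is, up to [del], a finite sum of
    indicators of closed sets, to which the bound on visit frequencies applies. *)
Lemma uniquely_ergodic_usc h (C : R) (e : R) : measurable_fun setT h ->
  (forall y, 0 <= h y <= C)%R -> (forall c, closed [set y | c <= h y]%R) ->
  (0 < e)%R ->
  \forall N \near \oo, forall x, (orbit_mean T N h x <= \int[mu]_y h y + e)%R.
Proof.
move=> mh hC clh e0.
pose del := (e / 2)%R.
have del0 : (0 < del)%R by rewrite divr_gt0.
pose Q := (Num.truncn (C / del)).+1.
have hQ y : (0 <= h y <= Q%:R * del)%R.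
  have /andP[h0 hy] := hC y; rewrite h0 /= (le_trans hy)//.
  by rewrite -ler_pdivrMr// ltW// truncnS_gt.
have mlayer i : measurable (layer h del i) by exact/closed_measurable/clh.
have int_layers :
    (\sum_(i < Q) del * fine (mu (layer h del i.+1)) <= \int[mu]_y h y)%R.
  have pos i y : 0 <= (del * \1_(layer h del i) y)%:E.
    by rewrite lee_fin mulr_ge0//; exact: ltW.
  have inth := bounded_integrable mu mh (C := C) _.
  rewrite -lee_fin /Rintegral fineK; last first.
    apply: integrable_fin_num => //; apply: inth => y.
    by have /andP[h0 hy] := hC y; rewrite ger0_norm.
  apply: (@le_trans _ _
    (\int[mu]_y (\sum_(i < Q) (del * \1_(layer h del i.+1) y)%:E))).
    rewrite ge0_integral_sum//; last first.
      move=> i; apply/measurable_EFinP; exact: measurable_funM.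
    rewrite -sumEFin; apply: lee_sum => i _.
    under eq_integral do rewrite EFinM.
    rewrite ge0_integralZl//; last 2 first.
    - apply/measurable_EFinP; exact: measurable_indic.
    - by rewrite lee_fin ltW.
    rewrite integral_indic// setIT EFinM fineK// fin_num_measure//.
  apply: ge0_le_integral => //.
  - by move=> y _; apply: sume_ge0 => i _; exact: pos.
  - apply: emeasurable_sum => i; apply/measurable_EFinP.
    exact: measurable_funM.
  - exact/measurable_EFinP.
  - move=> y _; rewrite sumEFin lee_fin.
    by have /andP[] := layer_cake del0 (hQ y).
have near_layers : \forall N \near \oo, forall i : 'I_Q, forall x,
    (orbit_mean T N \1_(layer h del i.+1) x <=
     fine (mu (layer h del i.+1)) + Q%:R^-1)%R.
  apply: filter_forall => i; apply: uniquely_ergodic_closed => //.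
    exact: clh.
  by rewrite invr_gt0.
near=> N => x.
apply: (@le_trans _ _ (orbit_mean T N
    (fun y => del + \sum_(i < Q) del * \1_(layer h del i.+1) y)%R x)).
  by apply: le_orbit_mean => y; have /andP[] := layer_cake del0 (hQ y).
rewrite orbit_meanD orbit_mean_cst; last by near: N; exact: nbhs_infty_gt.
rewrite orbit_mean_sum.
apply: (@le_trans _ _ (del + \sum_(i < Q)
    del * (fine (mu (layer h del i.+1)) + Q%:R^-1)))%R.
  rewrite lerD2l; apply: ler_sum => i _; rewrite orbit_meanZ.
  rewrite ler_wpM2l//; first exact: ltW.
  move: i x; near: N; exact: near_layers.
under eq_bigr do rewrite mulrDr.
rewrite big_split /= sumr_const card_ord -[X in (_ + (_ + X))%R]mulr_natr.
rewrite mulfVK ?pnatr_eq0//.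
by rewrite [e]splitr -/del; lra.
Unshelve. all: by end_near. Qed.

(** Both [h] and [C - h] are upper semicontinuous. *)
Lemma uniquely_ergodic_continuous h (C : R) (e : R) : measurable_fun setT h ->
  (forall y, 0 <= h y <= C)%R -> (forall c, closed [set y | c <= h y]%R) ->
  (forall c, closed [set y | h y <= c]%R) -> (0 < e)%R ->
  \forall N \near \oo, forall x,
    (`|orbit_mean T N h x - \int[mu]_y h y| <= e)%R.
Proof.
move=> mh hC clh clh' e0.
have hC' y : (0 <= C - h y <= C)%R.
  by have /andP[h0 hy] := hC y; rewrite subr_ge0 hy gerBl.
have mh' : measurable_fun setT (fun y => C - h y)%R by exact: measurable_funB.
have clC c : closed [set y | c <= C - h y]%R.
  by under eq_set do rewrite lerBrDr -lerBrDl; exact: clh'.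
have inth : mu.-integrable setT (EFin \o h).
  apply: (bounded_integrable mu mh (C := C)) => y.
  by have /andP[h0 hy] := hC y; rewrite ger0_norm.
have intC : (\int[mu]_y (C - h y) = C - \int[mu]_y h y)%R.
  have icst : mu.-integrable setT (EFin \o (fun=> C)).
    by apply: (@bounded_integrable _ _ _ mu _ `|C|%R) => [|x];
      [exact: measurable_cst|].
  rewrite RintegralB// Rintegral_cst// (_ : _ setT = 1) ?mulr1//.
  exact: probability_setT.
near=> N => x.
have N0 : (0 < N)%N by near: N; exact: nbhs_infty_gt.
have Hu : (orbit_mean T N h x <= \int[mu]_y h y + e)%R.
  by move: x; near: N; exact: uniquely_ergodic_usc hC clh e0.
have : (orbit_mean T N (fun y => C - h y) x <= \int[mu]_y (C - h y) + e)%R.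
  move: x Hu; near: N.
  by apply: filterS (uniquely_ergodic_usc mh' hC' clC e0) => k + x _.
have -> : (orbit_mean T N (fun y => C - h y) x = C - orbit_mean T N h x)%R.
  rewrite (orbit_meanD _ _ (fun=> C) (fun y => - h y)%R) orbit_mean_cst//.
  under [X in orbit_mean _ _ X]eq_fun do rewrite -mulN1r.
  by rewrite orbit_meanZ mulN1r.
rewrite intC ler_norml => Hl; apply/andP; split; lra.
Unshelve. all: by end_near. Qed.

End uniform_ergodic_theorem.
(** * Trimmed sums and fractional weights *)

Section trimming_weights.
Context {R : realType}.

(** Among the sets of [k] indices take one with the largest sum; exchanging one
    index against another cannot increase that sum. *)
Lemma exists_top_set (N k : nat) (a : 'I_N -> R) : (k <= N)%N ->
  exists2 A : {set 'I_N}, #|A| = k &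
    forall i j, i \in A -> j \notin A -> (a j <= a i)%R.
Proof.
move=> kN.
have [A0 A0k] : exists A0 : {set 'I_N}, #|A0| == k.
  have : (0 < #|[set A : {set 'I_N} | #|A| == k]%SET|)%N.
    by rewrite card_draws card_ord bin_gt0.
  by case/card_gt0P => A; rewrite inE => Ak; exists A.
pose sum_on (A : {set 'I_N}) := (\sum_(i in A) a i)%R.
case: (@arg_maxP _ R _ A0 (fun A : {set 'I_N} => #|A| == k) sum_on A0k).
move=> A /eqP Ak Amax; exists A => // i j iA jA.
have jAi : j \notin A :\ i by rewrite !inE negb_and jA orbT.
have : (sum_on (j |: (A :\ i)) <= sum_on A)%R.
  by apply: Amax; rewrite cardsU1 jAi -Ak [X in _ == X](cardsD1 i) iA.
by rewrite /sum_on big_setU1//= (big_setD1 i iA) /= lerD2r.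
Qed.

(** Removing whole terms is at least as effective as removing fractions of terms
    of the same total weight: the largest value [th] outside [A] separates the
    values inside [A] from those outside. *)
Lemma sum_weights_le_top (N : nat) (a w : 'I_N -> R) (A : {set 'I_N}) :
  (forall i, 0 <= a i)%R -> (forall i, 0 <= w i <= 1)%R ->
  (forall i j, i \in A -> j \notin A -> (a j <= a i)%R) ->
  (\sum_i w i <= #|A|%:R)%R -> (\sum_i a i * w i <= \sum_(i in A) a i)%R.
Proof.
move=> a0 w01 topA wA.
pose th := (\big[Num.max/0]_(j | j \notin A) a j)%R.
have th0 : (0 <= th)%R by rewrite /th; apply: bigmax_ge_id.
have a_le j : j \notin A -> (a j <= th)%R by move=> jA; exact: le_bigmax_cond.
have le_a i : i \in A -> (th <= a i)%R.
  by move=> iA; apply: bigmax_le => // j jA; exact: topA.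
rewrite (bigID (mem A)) /=.
have out : (\sum_(i | i \notin A) a i * w i <= th * \sum_(i | i \notin A) w i)%R.
  rewrite mulr_sumr; apply: ler_sum => i iA.
  by have /andP[w0 _] := w01 i; rewrite ler_wpM2r// a_le.
have inn : (th * \sum_(i in A) (1 - w i) <= \sum_(i in A) a i * (1 - w i))%R.
  rewrite mulr_sumr; apply: ler_sum => i iA.
  by have /andP[_ w1] := w01 i; rewrite ler_wpM2r ?le_a// subr_ge0.
have E1 : (\sum_(i in A) a i * (1 - w i) =
    \sum_(i in A) a i - \sum_(i in A) a i * w i)%R.
  by rewrite -sumrB; apply: eq_bigr => i _; rewrite mulrBr mulr1.
have E2 : (\sum_(i in A) (1 - w i) = #|A|%:R - \sum_(i in A) w i)%R.
  by rewrite sumrB sumr_const.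
rewrite E1 E2 in inn.
rewrite (bigID (mem A)) /= in wA.
have := ler_wpM2l th0 wA; rewrite mulrDr => thA.
rewrite mulrBr in inn.
move: out inn thA; move: (th * _)%R (th * _)%R (th * _)%R => p q r *; lra.
Qed.

Context {X : Type} (T : X -> X).
Implicit Types h w : X -> R.

(** Fractional weights are what allows a trimmed sum to be bounded by Birkhoff
    sums of continuous functions, where an exact cutoff at a threshold would
    require the indicator of a level set. *)
Lemma trimmed_sum_le_weights h w (N k : nat) x : (k <= N)%N ->
  (forall y, 0 <= h y)%R -> (forall y, 0 <= w y <= 1)%R ->
  (\sum_(n < N) w (iter n T x) <= k%:R)%R ->
  trimmed_sum T (EFin \o h) N k x <=
    (\sum_(n < N) h (iter n T x) * (1 - w (iter n T x)))%:E.
Proof.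
move=> kN h0 w01 wk.
have [A Ak topA] := exists_top_set (fun n : 'I_N => h (iter n T x)) kN.
rewrite -Ak in wk.
have le_top := sum_weights_le_top (fun n : 'I_N => h0 (iter n T x))
  (fun n : 'I_N => w01 (iter n T x)) topA wk.
rewrite /trimmed_sum kN sumEFin.
apply: (@le_trans _ _ ((\sum_(n < N) h (iter n T x))%:E -
    (\sum_(n in A) h (iter n T x))%:E)).
  apply: leeB => //; rewrite -sumEFin.
  apply: (@le_bigmax_cond _ _ _ -oo A (fun A : {set 'I_N} => #|A| == k)
    (fun A : {set 'I_N} => \sum_(n in A) (EFin \o h) (iter n T x))).
  exact/eqP.
rewrite -EFinB lee_fin.
under [leRHS]eq_bigr do rewrite mulrBr mulr1.
by rewrite sumrB lerB.
Qed.

(** Truncating at [s] only decreases the terms that are kept, and it lowers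
    each of the [k] removed terms to at most [s]. *)
Lemma trimmed_sum_ge_truncated h (N k : nat) (s : R) x :
  (k <= N)%N -> (0 <= s)%R ->
  (\sum_(n < N) Num.min (h (iter n T x)) s - s * k%:R)%:E <=
  trimmed_sum T (EFin \o h) N k x.
Proof.
move=> kN s0; rewrite /trimmed_sum kN sumEFin.
set Z := (\sum_(n < N) h (iter n T x) -
  \sum_(n < N) Num.min (h (iter n T x)) s + s * k%:R)%R.
apply: (@le_trans _ _ ((\sum_(n < N) h (iter n T x))%:E - Z%:E)).
  by rewrite -EFinB lee_fin /Z; lra.
apply: leeB => //; apply: bigmax_le; first exact: leNye.
move=> A /eqP Ak; rewrite sumEFin lee_fin /Z -sumrB.
rewrite [X in (_ <= X + _)%R](bigID (mem A)) /=.
have out : (0 <= \sum_(i < N | i \notin A)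
    (h (iter i T x) - Num.min (h (iter i T x)) s))%R.
  by apply: sumr_ge0 => i _; rewrite subr_ge0 ge_min lexx.
have inn : (\sum_(i in A) Num.min (h (iter i T x)) s <= s * k%:R)%R.
  rewrite -Ak mulr_natr -sumr_const; apply: ler_sum => i _.
  by rewrite ge_min lexx orbT.
by rewrite sumrB; lra.
Qed.

End trimming_weights.
(** * Estimating a trimmed sum by orbit means of truncations *)

Section truncation.
Context {R : realType} {X : Type}.
Variable f : X -> \bar R.
Hypothesis f_ge0 : forall x, 0 <= f x.
Implicit Types (s t r : R).

Definition trunc t x : R := fine (mine (f x) t%:E).

(** A soft indicator of [f > s]: it is [0] up to [s], [1] from [s + 1] on, and it
    inherits the continuity of the truncations. *)
Definition tail_weight s x : R := (trunc (s + 1) x - trunc s x)%R.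

(** The levels at which the orbit means of [f] must be under control in order to
    trim at [s], when the visits to [f = +oo] are counted by [tail_weight r]. *)
Definition levels s r : seq R := [:: s; s + 1; r; r + 1]%R.

Lemma truncE t x : trunc t x = if f x == +oo then t else Num.min (fine (f x)) t.
Proof.
rewrite /trunc; have := f_ge0 x; case: (f x) => [r r0| _|//] /=.
  by rewrite -EFin_min.
done.
Qed.

Lemma EFin_trunc t x : (trunc t x)%:E = mine (f x) t%:E.
Proof.
rewrite /trunc; have := f_ge0 x; case: (f x) => [r r0| _|//].
  by rewrite -EFin_min.
done.
Qed.

Lemma trunc_ge0 t x : (0 <= t)%R -> (0 <= trunc t x)%R.
Proof.
by move=> t0; rewrite truncE; case: ifP => // _; rewrite le_min t0 fine_ge0.
Qed.

Lemma trunc_le t x : (trunc t x <= t)%R.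
Proof. by rewrite truncE; case: ifP => // _; rewrite ge_min lexx orbT. Qed.

Lemma tail_weight_itv s x : (0 <= tail_weight s x <= 1)%R.
Proof.
rewrite /tail_weight !truncE; case: ifP => _.
  by apply/andP; split; lra.
move: (fine (f x)) => a.
by apply/andP; case: (leP a s); case: (leP a (s + 1)%R) => *; split; lra.
Qed.

(** The left side is what is kept of [hat f] when a fraction [tail_weight s] of
    each value is removed.  For a value [s + w] with [0 <= w <= 1] it equals
    [(s + w) * (1 - w)], while the right side is [s - (s - 1) * w]. *)
Lemma hat_weight_le s x :
  (fine (f x) * (1 - tail_weight s x) <= trunc s x - (s - 1) * tail_weight s x)%R.
Proof.
rewrite /tail_weight !truncE; case: ifP => [/eqP ->|_].
  by rewrite /= mul0r; lra.
move: (fine (f x)) => a.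
case: (leP a s); case: (leP a (s + 1)%R) => *; nra.
Qed.

(** The correction term pays for the points where [f] is infinite: there [hat f]
    vanishes while [trunc s] is [s], and [tail_weight t] is [1] for every [t]. *)
Lemma trunc_le_hat s t x : (0 <= s)%R ->
  (trunc s x - s * tail_weight t x <= Num.min (fine (f x)) s)%R.
Proof.
move=> s0; have /andP[w0 w1] := tail_weight_itv t x.
move: w0 w1; rewrite /tail_weight !truncE; case: ifP => [/eqP ->|_] w0 w1.
  by rewrite (min_idPl _)//=; lra.
by rewrite lerBlDr lerDl mulr_ge0.
Qed.

Lemma hatE : hat f = EFin \o (fun x => fine (f x)).
Proof.
apply/funext => x; rewrite /hat /=; have := f_ge0 x.
by case: (f x) => [r _| _|//]; rewrite ?eqxx.
Qed.

Variable (T : X -> X).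

Lemma trimmed_sum_hat_le (s : R) (N k : nat) x : (k <= N)%N ->
  (\sum_(n < N) tail_weight s (iter n T x) <= k%:R)%R ->
  trimmed_sum T (hat f) N k x <=
  (\sum_(n < N) (trunc s (iter n T x) - (s - 1) * tail_weight s (iter n T x)))%:E.
Proof.
move=> kN wk; rewrite hatE.
apply: (le_trans (trimmed_sum_le_weights kN _ (tail_weight_itv s) wk)).
  by move=> y; rewrite fine_ge0.
by rewrite lee_fin; apply: ler_sum => n _; exact: hat_weight_le.
Qed.

Lemma trimmed_sum_hat_ge (s r : R) (N k : nat) x : (k <= N)%N -> (0 <= s)%R ->
  (\sum_(n < N) (trunc s (iter n T x) - s * tail_weight r (iter n T x))
    - s * k%:R)%:E <= trimmed_sum T (hat f) N k x.
Proof.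
move=> kN s0; rewrite hatE.
apply: le_trans (trimmed_sum_ge_truncated _ _ x kN s0).
by rewrite lee_fin lerD2r; apply: ler_sum => n _; exact: trunc_le_hat.
Qed.

Variable I : R -> R.

(** In applications [I t] is the space mean of [trunc t].  The number [k] exceeds
    the total tail weight along the orbit, but by at most [4 * e * N + 1], and
    each superfluous removal costs at most [s].  With [s * e <= 1 / 8] and
    [s <= N] this is a bounded multiple of [N], and so are the error
    [hat_weight_le] leaves between both bounds and the correction for infinite
    values: hence the absolute constant [3]. *)
Lemma trimmed_sum_estimate (s r e : R) (N k : nat) x :
  (0 < N)%N -> (k <= N)%N -> (0 < e)%R -> (1 <= s)%R -> (s * e <= 1 / 8)%R ->
  (s <= N%:R)%R -> (I (s + 1) - I s <= 1)%R -> (s * (I (r + 1) - I r) <= 1)%R ->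
  (N%:R * (I (s + 1) - I s + 2 * e) <= k%:R)%R ->
  (k%:R <= N%:R * (I (s + 1) - I s + 2 * e) + 1)%R ->
  (forall t, t \in levels s r ->
    `| orbit_mean T N (trunc t) x - I t | <= e)%R ->
  forall D, D = (I s - s * (I (s + 1) - I s))%R ->
  (N%:R * (D - 3))%:E <= trimmed_sum T (hat f) N k x <= (N%:R * (D + 3))%:E.
Proof.
move=> N0 kN e0 s1 se sN p1 pr1 kge kle HI D DE.
have n0 : (0 < N%:R :> R)%R by rewrite ltr0n.
have s0 : (0 <= s)%R by lra.
have sumE (h : X -> R) : (\sum_(n < N) h (iter n T x) = N%:R * orbit_mean T N h x)%R.
  by rewrite /orbit_mean mulrA mulfV ?mul1r// gt_eqF.
have wE t : orbit_mean T N (tail_weight t) x =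
    (orbit_mean T N (trunc (t + 1)) x - orbit_mean T N (trunc t) x)%R.
  rewrite (_ : tail_weight t = fun y => trunc (t + 1) y + -1 * trunc t y)%R.
    by rewrite orbit_meanD orbit_meanZ mulN1r.
  by apply/funext => y; rewrite mulN1r.
have h1 := HI s (mem_head _ _).
have h2 : (`|orbit_mean T N (trunc (s + 1)) x - I (s + 1)| <= e)%R.
  by apply: HI; rewrite /levels !inE eqxx orbT.
have h3 : (`|orbit_mean T N (trunc r) x - I r| <= e)%R.
  by apply: HI; rewrite /levels !inE eqxx !orbT.
have h4 : (`|orbit_mean T N (trunc (r + 1)) x - I (r + 1)| <= e)%R.
  by apply: HI; rewrite /levels !inE eqxx !orbT.
move: h1 h2 h3 h4; rewrite !ler_distl.
move=> /andP[h1 h1'] /andP[h2 h2'] /andP[h3 h3'] /andP[h4 h4'].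
have wk : (\sum_(n < N) tail_weight s (iter n T x) <= k%:R)%R.
  apply: le_trans kge; rewrite sumE ler_wpM2l// wE; lra.
apply/andP; split.
  apply: le_trans (trimmed_sum_hat_ge r x kN s0); rewrite lee_fin.
  rewrite (sumE (fun y => trunc s y - s * tail_weight r y)%R).
  rewrite (_ : orbit_mean _ _ _ _ = orbit_mean T N (trunc s) x -
     s * (orbit_mean T N (trunc (r + 1)) x - orbit_mean T N (trunc r) x))%R;
    last first.
    rewrite -wE -mulNr -orbit_meanZ -orbit_meanD; congr (orbit_mean _ _ _ _).
    by apply/funext => y; rewrite mulNr.
  have sk : (s * k%:R <= s * (N%:R * (I (s + 1) - I s + 2 * e) + 1))%R.
    by rewrite ler_wpM2l.
  apply: (@le_trans _ _ (N%:R * (orbit_mean T N (trunc s) x -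
    s * (orbit_mean T N (trunc (r + 1)) x - orbit_mean T N (trunc r) x)) -
    (s * (N%:R * (I (s + 1) - I s + 2 * e) + 1)))%R); last by rewrite lerD2l lerN2.
  have key : (D - 2 <= orbit_mean T N (trunc s) x -
    s * (orbit_mean T N (trunc (r + 1)) x - orbit_mean T N (trunc r) x) -
    s * (I (s + 1) - I s + 2 * e))%R.
    rewrite DE.
    have : (s * (orbit_mean T N (trunc (r + 1)) x -
        orbit_mean T N (trunc r) x) <= s * (I (r + 1) - I r + 2 * e))%R.
      by rewrite ler_wpM2l//; lra.
    rewrite !mulrDr; nra.
  have := ler_wpM2l (ltW n0) key; nra.
apply: (le_trans (trimmed_sum_hat_le kN wk)).
rewrite lee_fin (sumE (fun y => trunc s y - (s - 1) * tail_weight s y)%R).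
rewrite (_ : orbit_mean _ _ _ _ = orbit_mean T N (trunc s) x -
   (s - 1) * (orbit_mean T N (trunc (s + 1)) x - orbit_mean T N (trunc s) x))%R;
  last first.
  rewrite -wE -mulNr -orbit_meanZ -orbit_meanD; congr (orbit_mean _ _ _ _).
  by apply/funext => y; rewrite mulNr.
rewrite ler_wpM2l// DE.
have : ((s - 1) * (I (s + 1) - I s - 2 * e) <= (s - 1) *
   (orbit_mean T N (trunc (s + 1)) x - orbit_mean T N (trunc s) x))%R.
  by rewrite ler_wpM2l//; lra.
nra.
Qed.

End truncation.
(** * A trimming scheme of prescribed accuracy *)

Section trimming_scheme.
Context {d : measure_display} {X : measurableType d} {R : realType}.
Variables (mu : probability X R) (f : X -> \bar R).
Hypothesis obs : nonintegrable_observable mu f.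

Let f_ge0 x : 0 <= f x. Proof. by have [] := obs. Qed.
Let mf : measurable_fun setT f. Proof. by have [] := obs. Qed.

Lemma measurable_trunc t : measurable_fun setT (trunc f t).
Proof.
apply: (@measurableT_comp _ _ _ _ _ _ fine); first exact: fine_measurable.
by apply: measurable_mine => //; exact: measurable_cst.
Qed.

Lemma trunc_bounded (t : R) x : (0 <= t)%R -> (`|trunc f t x| <= t)%R.
Proof. by move=> t0; rewrite ger0_norm ?trunc_ge0// trunc_le. Qed.

Let integrable_trunc (t : R) : (0 <= t)%R ->
  mu.-integrable setT (EFin \o trunc f t).
Proof.
move=> t0; apply: (bounded_integrable mu (measurable_trunc t)) => x.
exact: trunc_bounded.
Qed.

Local Notation I t := (\int[mu]_x trunc f t x)%R.

Let Rint_tail_weight (s : R) : (0 <= s)%R ->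
  (I (s + 1) - I s = \int[mu]_x tail_weight f s x)%R.
Proof. by move=> s0; rewrite -RintegralB ?integrable_trunc ?addr_ge0. Qed.

Let measurable_tail_weight s : measurable_fun setT (tail_weight f s).
Proof. by apply: measurable_funB; exact: measurable_trunc. Qed.

Let tail_weight_bounded s x : (`|tail_weight f s x| <= 1)%R.
Proof. by have /andP[w0 w1] := tail_weight_itv f_ge0 s x; rewrite ger0_norm. Qed.

Let integrable_tail_weight s : mu.-integrable setT (EFin \o tail_weight f s).
Proof. exact: (bounded_integrable mu _ (tail_weight_bounded s)). Qed.

Let Rint_le1 (s : R) : (\int[mu]_x tail_weight f s x <= 1)%R.
Proof.
rewrite -[leRHS](_ : \int[mu]_x (cst 1 x) = 1)%R.
  apply: le_Rintegral => //.
    apply: (@bounded_integrable _ _ _ mu (cst 1%R) 1%R) => //= x.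
    by rewrite normr1.
  by move=> x _; have /andP[] := tail_weight_itv f_ge0 s x.
rewrite Rintegral_cst// (_ : _ setT = 1) ?mulr1//.
exact: probability_setT.
Qed.

Let ae_finite : {ae mu, forall x, f x != +oo}.
Proof.
have [_ _ _ f0] := obs.
exists (f @^-1` [set +oo]); split => //.
  by rewrite -[X in measurable X]setTI; exact: mf.
by move=> x /= /negP; rewrite negbK => /eqP.
Qed.

Let near_untruncated x : f x != +oo -> \forall n \near \oo,
  trunc f n%:R x = fine (f x) /\ tail_weight f n%:R x = 0%R.
Proof.
move=> fx; near=> n.
have fn : (fine (f x) <= n%:R)%R by near: n; exact: nbhs_infty_ger.
rewrite /tail_weight !truncE// (negbTE fx); move: fn; move: (fine (f x)) => a an.
have an1 : (a <= n%:R + 1)%R by lra.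
by rewrite (min_idPl an) (min_idPl an1) subrr.
Unshelve. all: by end_near. Qed.

Let tail_weight_cvg0 (e : R) : (0 < e)%R ->
  \forall n \near \oo, (\int[mu]_x tail_weight f n%:R x <= e)%R.
Proof.
move=> e0.
have [_ _ lim_int] : [/\ mu.-integrable setT (cst 0),
    [sequence \int[mu]_x `|(tail_weight f n%:R x)%:E - cst 0 x|]_n @ \oo --> 0 &
    [sequence \int[mu]_x (tail_weight f n%:R x)%:E]_n @ \oo -->
      \int[mu]_x (cst 0 x)].
  apply: (@dominated_convergence _ X R mu setT measurableT
    (fun n x => (tail_weight f n%:R x)%:E) (cst 0) (cst 1%E)).
  - by move=> n; exact/measurable_EFinP.
  - exact: measurable_cst.
  - apply: filterS ae_finite => x fx _; apply: cvg_near_cst.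
    by apply: filterS (near_untruncated fx) => n [_ ->].
  - apply: (@bounded_integrable _ _ _ mu (cst 1%R) 1%R) => //= x.
    by rewrite normr1.
  - by apply: aeW => x n _; rewrite lee_fin.
rewrite integral0 in lim_int.
have : (\int[mu]_x tail_weight f n%:R x)%R @[n --> \oo] --> (0 : R)%R.
  exact: fine_cvg lim_int.
move=> /cvgr_dist_le /(_ e e0); apply: filterS => n.
by rewrite /= sub0r normrN => /(le_trans (ler_norm _)).
Qed.

(** The pointwise form of the normalization [I s - s * (I (s + 1) - I s)].  It
    increases to [hat f] as [n] grows, also where [f] is infinite. *)
Let core (n : nat) (x : X) : R := (trunc f n%:R x - n%:R * tail_weight f n%:R x)%R.

Let core_ge0 n x : (0 <= core n x)%R.
Proof.
rewrite /core /tail_weight !truncE//; case: ifP => _; first by lra.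
have := fine_ge0 (f_ge0 x); move: (fine (f x)) => a a0.
have n0 : (0 <= n%:R :> R)%R by [].
by case: (leP a n%:R%R); case: (leP a (n%:R + 1)%R) => *; nra.
Qed.

Let core_homo x : {homo core ^~ x : m n / (m <= n)%N >-> (m <= n)%R}.
Proof.
apply: homo_leq => // [|n]; first exact: le_trans.
rewrite /core /tail_weight !truncE//; case: ifP => _.
  by rewrite -natr1; lra.
have := fine_ge0 (f_ge0 x); move: (fine (f x)) => a a0.
have n0 : (0 <= n%:R :> R)%R by [].
rewrite -natr1; move: (n%:R : R)%R n0 => m m0.
by case: (leP a m%R); case: (leP a (m + 1)%R);
  case: (leP a (m + 1 + 1)%R) => *; nra.
Qed.

Let integrable_core n : mu.-integrable setT (EFin \o core n).
Proof.
rewrite /core (_ : EFin \o _ = (fun x => (trunc f n%:R x)%:E -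
    (n%:R * tail_weight f n%:R x)%:E)); last by apply/funext.
apply: integrableB => //; first exact: integrable_trunc.
apply: (@bounded_integrable _ _ _ mu
  (fun x => n%:R * tail_weight f n%:R x)%R n%:R).
  by apply: measurable_funM => //; exact: measurable_cst.
move=> x; rewrite normrM ger0_norm// ler_piMr//.
Qed.

Let Rint_core n : (\int[mu]_x core n x = I n%:R - n%:R * (I (n%:R + 1) - I n%:R))%R.
Proof.
rewrite Rint_tail_weight// -RintegralZl// -RintegralB//.
  exact: integrable_trunc.
apply: (@bounded_integrable _ _ _ mu
  (fun x => n%:R * tail_weight f n%:R x)%R n%:R).
  by apply: measurable_funM => //; exact: measurable_cst.
move=> x; rewrite normrM ger0_norm// ler_piMr//.
Qed.

Let core_cvgy (C : R) : \forall n \near \oo, (C <= \int[mu]_x core n x)%R.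
Proof.
have mcore n : measurable_fun setT (EFin \o core n).
  by have /integrableP[] := integrable_core n.
have mfine : measurable_fun setT (EFin \o (fine \o f)).
  apply/measurable_EFinP; apply: measurableT_comp => //; exact: fine_measurable.
have int_oo : \int[mu]_x (fine (f x))%:E = +oo.
  have [_ _ <- _] := obs; apply: ge0_ae_eq_integral => //.
    by move=> x _; rewrite lee_fin fine_ge0.
  apply: filterS ae_finite => x fx _; rewrite fineK// ge0_fin_numE//.
  by rewrite lt_neqAle fx leey.
have core_lim x : limn (fun n => (core n x)%:E) = (fine (f x))%:E.
  apply/cvg_lim => //; apply: cvg_near_cst.
  have [fx|fx] := eqVneq (f x) +oo.
    apply: nearW => n.
    by rewrite /core /tail_weight !truncE// fx eqxx /=; congr _%:E; ring.
  apply: filterS (near_untruncated fx) => n [H1 H2].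
  by rewrite /core H1 H2 mulr0 subr0.
have ndcore x : setT x -> nondecreasing_seq (fun n => (core n x)%:E).
  by move=> _ m n mn; rewrite lee_fin core_homo.
have core0 n x : setT x -> 0 <= (EFin \o core n) x by move=> _; rewrite lee_fin.
have := cvg_monotone_convergence (mu := mu) measurableT mcore core0 ndcore.
under eq_integral do rewrite core_lim.
rewrite int_oo => /cvgey_ge /(_ C); apply: filterS => n.
move=> Cn; rewrite -lee_fin /Rintegral fineK; first exact: Cn.
apply: integrable_fin_num => //; exact: integrable_core.
Qed.

(** First take [s] so large that the tail weight has small mean, which makes [k]
    a small fraction of [N], and that the normalization [D] is large compared
    with the error [3] of [trimmed_sum_estimate].  The level [r], and then the
    tolerance [e], are chosen according to [s]. *)
Lemma trimming_scheme (eta : R) : (0 < eta)%R ->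
  exists (s r : nat) (e q D : R), [/\ (0 < e)%R, (0 < D)%R & \forall N \near \oo,
    let k := (Num.truncn (N%:R * q)).+1 in
    [/\ (k <= N)%N, (k%:R <= eta * N%:R)%R &
    forall (T : X -> X) x, (forall t, t \in levels s%:R r%:R ->
        `| orbit_mean T N (trunc f t) x - \int[mu]_y trunc f t y | <= e)%R ->
      `| trimmed_sum T (hat f) N k x * ((N%:R * D)^-1)%:E - 1 | <= eta%:E]].
Proof.
move=> eta0.
pose eta1 := Num.min eta 1%R.
have eta10 : (0 < eta1)%R by rewrite lt_min eta0 ltr01.
have eta1le : (eta1 <= eta)%R by rewrite ge_min lexx.
have eta1le1 : (eta1 <= 1)%R by rewrite ge_min lexx orbT.
have eta14 : (0 < eta1 / 4)%R by rewrite divr_gt0.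
have [s [s1 ps Ds]] : exists s : nat, [/\ (1 <= s)%N,
    (\int[mu]_x tail_weight f s%:R x <= eta1 / 4)%R &
    (3 / eta1 <= \int[mu]_x core s x)%R].
  near \oo => s; exists s; split; near: s.
  - exact: nbhs_infty_ge.
  - exact: tail_weight_cvg0.
  - exact: core_cvgy.
have s0 : (0 < s%:R :> R)%R by rewrite ltr0n.
have sge1 : (1 <= s%:R :> R)%R by rewrite ler1n.
have [r pr] : exists r : nat, (\int[mu]_x tail_weight f r%:R x <= s%:R^-1)%R.
  near \oo => r; exists r; near: r.
  by apply: tail_weight_cvg0; rewrite invr_gt0.
pose D := (\int[mu]_x core s x)%R.
pose e := Num.min (8 * s%:R)^-1%R (eta1 / 8)%R.
have e0 : (0 < e)%R by rewrite lt_min invr_gt0 mulr_gt0//= divr_gt0.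
have se : (s%:R * e <= 1 / 8)%R.
  apply: (@le_trans _ _ (s%:R * (8 * s%:R)^-1)%R).
    by rewrite ler_pM2l// ge_min lexx.
  by rewrite invfM mulrCA mulfV ?gt_eqF// mulr1 div1r.
have ee : (e <= eta1 / 8)%R by rewrite ge_min lexx orbT.
pose p := (I (s%:R + 1) - I s%:R)%R.
have pE : p = (\int[mu]_x tail_weight f s%:R x)%R by exact: Rint_tail_weight.
have p0 : (0 <= p)%R.
  rewrite pE; apply: Rintegral_ge0 => x _.
  by have /andP[] := tail_weight_itv f_ge0 s%:R x.
have p1 : (p <= 1)%R by rewrite pE.
have D0 : (0 < D)%R by apply: lt_le_trans Ds; rewrite divr_gt0.
exists s, r, e, (p + 2 * e)%R, D; split => //.
near=> N.
have N0 : (0 < N)%N by near: N; exact: nbhs_infty_gt.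
have N0' : (0 < N%:R :> R)%R by rewrite ltr0n.
have sN : (s%:R <= N%:R :> R)%R by rewrite ler_nat; near: N; exact: nbhs_infty_ge.
have NE : (2 / eta1 <= N%:R)%R by near: N; exact: nbhs_infty_ger.
rewrite ler_pdivrMr// in NE.
have q0 : (0 <= N%:R * (p + 2 * e))%R by rewrite mulr_ge0// addr_ge0// mulr_ge0// ltW.
have /andP[k1 k2] := truncn_itv q0.
set k := (Num.truncn (N%:R * (p + 2 * e))).+1 => /=.
have k3 : (k%:R <= N%:R * (p + 2 * e) + 1)%R by rewrite /k -natr1 lerD2r.
have kN : (k%:R <= eta1 * N%:R)%R.
  apply: le_trans k3 _.
  have : (N%:R * (p + 2 * e) <= N%:R * (eta1 / 2))%R.
    by rewrite ler_pM2l// pE; lra.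
  lra.
have kleN : (k <= N)%N.
  by rewrite -(ler_nat R) (le_trans kN)// ler_piMl.
split => //; first by apply: le_trans kN _; rewrite ler_pM2r.
move=> T x HI.
have := @trimmed_sum_estimate R X f f_ge0 T (fun t => \int[mu]_y trunc f t y)%R
  s%:R r%:R e N k x N0 kleN e0 sge1 se sN p1 _ (ltW k2) k3 HI D _.
rewrite Rint_tail_weight// mulrC -ler_pdivlMr// div1r => /(_ pr).
rewrite -Rint_core => /(_ erefl).
case: (trimmed_sum T (hat f) N k x) => [tau||]; rewrite ?leye_eq ?leeNy_eq ?andbF//.
rewrite !lee_fin => /andP[t1 t2].
have ND0 : (0 < N%:R * D)%R by rewrite mulr_gt0.
have -> : (tau * (N%:R * D)^-1 - 1 = (tau - N%:R * D) / (N%:R * D))%R.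
  by rewrite mulrBl mulfV// gt_eqF.
rewrite normrM normfV (ger0_norm (ltW ND0)) ler_pdivrMr//.
apply: (@le_trans _ _ (N%:R * 3)%R).
  by rewrite ler_norml; apply/andP; split; lra.
rewrite mulrCA ler_pM2l//; apply: (@le_trans _ _ (eta1 * D)%R).
  by rewrite mulrC -ler_pdivrMr//.
by rewrite ler_pM2r.
Unshelve. all: by end_near. Qed.

End trimming_scheme.
(** * Truncations of an observable continuous for the exponential distance *)

Section exp_dist_continuity.
Context {d : measure_display} {R : realType} {X : borelMetricType d R}.
Variable f : X -> \bar R.
Hypothesis f_ge0 : forall x, 0 <= f x.
Hypothesis cf : exp_dist_continuous f.

Let u x : R := fine (expeR (- f x)).

Let continuous_u : continuous u.
Proof.
by move=> x; apply/cvgrPdist_lt => e e0; exact: cf.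
Qed.

Let le_u c x : (c%:E <= f x) = (u x <= expR (- c))%R.
Proof.
rewrite /u; have := f_ge0 x; case: (f x) => [r r0| _|//] /=.
  by rewrite lee_fin ler_expR lerN2.
by rewrite leey ltW// expR_gt0.
Qed.

Let ge_u c x : (f x <= c%:E) = (expR (- c) <= u x)%R.
Proof.
rewrite /u; have := f_ge0 x; case: (f x) => [r r0| _|//] /=.
  by rewrite lee_fin ler_expR lerN2.
by rewrite leye_eq /=; apply/esym/negbTE; rewrite -ltNge expR_gt0.
Qed.

Let closed_ge_f c : closed [set x | c%:E <= f x].
Proof.
under eq_set do rewrite le_u.
apply: (@closed_comp _ _ u [set y | y <= expR (- c)]%R); last exact: closed_le.
by move=> x _; exact: continuous_u.
Qed.

Let closed_le_f c : closed [set x | f x <= c%:E].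
Proof.
under eq_set do rewrite ge_u.
apply: (@closed_comp _ _ u [set y | expR (- c) <= y]%R); last exact: closed_ge.
by move=> x _; exact: continuous_u.
Qed.

Lemma closed_trunc_ge (t c : R) : closed [set x | c <= trunc f t x]%R.
Proof.
under eq_set do rewrite -lee_fin (EFin_trunc f_ge0) le_min lee_fin.
have [ct|tc] := leP c t.
  by under eq_set do rewrite andbT; exact: closed_ge_f.
rewrite (_ : mkset _ = set0); first exact: closed0.
by apply/seteqP; split => x //=; rewrite andbF.
Qed.

Lemma closed_trunc_le (t c : R) : closed [set x | trunc f t x <= c]%R.
Proof.
under eq_set do rewrite -lee_fin (EFin_trunc f_ge0) ge_min lee_fin.
have [tc|ct] := leP t c; last first.
  by under eq_set do rewrite orbF; exact: closed_le_f.
rewrite (_ : mkset _ = setT); first exact: closedT.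
by apply/seteqP; split => x //=; rewrite orbT.
Qed.

End exp_dist_continuity.
(** * Diagonal choice of the scheme *)

Section assembly.

(** Take for [J N] the largest [j <= N] with [M j <= N]. *)
Lemma slow_index (M : nat -> nat) : exists J : nat -> nat,
  (forall j, \forall N \near \oo, (j <= J N)%N) /\
  (\forall N \near \oo, (M (J N) <= N)%N).
Proof.
exists (fun N => \max_(j < N.+1 | (M j <= N)%N) j); split => [j|].
  near=> N.
  have jN : (j < N.+1)%N by rewrite ltnS; near: N; exact: nbhs_infty_ge.
  have MN : (M j <= N)%N by near: N; exact: nbhs_infty_ge.
  exact: (@leq_bigmax_cond _ (fun i : 'I_N.+1 => M i <= N)%N
    (fun i => i : nat) (Ordinal jN)).
near=> N.
have M0N : (M 0 <= N)%N by near: N; exact: nbhs_infty_ge.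
have /(eq_bigmax_cond (fun i : 'I_N.+1 => i : nat)) [i Pi ->] :
    (0 < #|(fun i : 'I_N.+1 => M i <= N)%N|)%N by apply/card_gt0P; exists ord0.
exact: Pi.
Unshelve. all: by end_near. Qed.

Lemma near_seq {A : eqType} {I : Type} (F : set_system I) {FF : Filter F}
  (ts : seq A) (P : A -> I -> Prop) :
  (forall t, t \in ts -> \forall i \near F, P t i) ->
  \forall i \near F, forall t, t \in ts -> P t i.
Proof.
elim: ts => [|a ts ih] H; first exact: nearW.
have Ha := H a (mem_head _ _).
have {}ih := ih (fun t tts => H t (mem_behead (s := a :: ts) tts)).
near=> i => t; rewrite inE => /predU1P[->|]; first by near: i.
by move: t; near: i.
Unshelve. all: by end_near. Qed.

(** An almost sure property of all large [N] fails after time [n] on a set whose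
    measure tends to [0] with [n].  Choosing [M j] such that it is at most
    [2 ^- j.+1], the Borel-Cantelli lemma applies. *)
Lemma eventual_to_uniform {d : measure_display} {X : measurableType d}
  {R : realType} (mu : probability X R) (E : nat -> nat -> set X) (N0 : nat -> nat) :
  (forall j N, measurable (E j N)) ->
  (forall j, {ae mu, forall x, \forall N \near \oo, E j N x}) ->
  exists M : nat -> nat, (forall j, (N0 j <= M j)%N) /\
    {ae mu, forall x, \forall j \near \oo, forall N, (M j <= N)%N -> E j N x}.
Proof.
move=> mE aeE.
pose B j n := \bigcup_(N in [set N | (n <= N)%N]) ~` E j N.
have mB j n : measurable (B j n).
  by apply: bigcup_measurable => N _; exact: measurableC.
have B0 j : mu (\bigcap_n B j n) = 0.
  have [A [mA A0 sA]] := aeE j.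
  apply/eqP; rewrite eq_le measure_ge0 andbT -A0.
  apply: le_measure; rewrite ?inE//.
    exact: bigcapT_measurable.
  move=> x Bx; apply: sA => /= -[n _ En].
  have [N /= nN] := Bx n I; apply; exact: En.
have small j : exists n, (N0 j <= n)%N /\ mu (B j n) <= (1 / (2 ^ j.+1)%:R)%:E.
  have cvgB : mu (B j n) @[n --> \oo] --> 0.
    rewrite -(B0 j); apply: nonincreasing_cvg_mu => //.
    - by rewrite -ge0_fin_numE// fin_num_measure.
    - exact: bigcapT_measurable.
    - move=> m n mn; apply/subsetPset => x [N /= nN ?]; exists N => //=.
      exact: leq_trans nN.
  have e0 : (0 < 1 / (2 ^ j.+1)%:R :> R)%R by rewrite divr_gt0// ltr0n expn_gt0.
  near \oo => n; exists n; split; first by near: n; exact: nbhs_infty_ge.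
  rewrite -[mu _]fineK ?fin_num_measure// lee_fin.
  near: n.
  have : (fine (mu (B j n)))%R @[n --> \oo] --> (0 : R)%R by exact: fine_cvg cvgB.
  move=> /cvgr_dist_le /(_ _ e0); apply: filterS => n.
  by rewrite /= sub0r normrN => /(le_trans (ler_norm _)).
have {small}[M HM] := choice small.
exists M; split => [j|]; first by have [] := HM j.
have : mu (lim_sup_set (fun j => B j (M j))) = 0.
  apply: lim_sup_set_cvg0 => //.
  apply: (@le_lt_trans _ _ 1%:E); last exact: ltry.
  apply: le_trans (epsilon_trick0 xpredT ler01).
  by apply: lee_nneseries => j _ //; have [] := HM j.
move=> L0; exists (lim_sup_set (fun j => B j (M j))); split => //.
  by apply: bigcapT_measurable => n; apply: bigcup_measurable.
move=> x /= nx n _; apply: contrapT => nB; apply: nx.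
exists n => // j /= nj N MN; apply: contrapT => nE; apply: nB.
by exists j => //; exists N.
Unshelve. all: by end_near. Qed.

Context {d : measure_display} {X : measurableType d} {R : realType}.
Variables (mu : probability X R) (f : X -> \bar R).
Hypothesis obs : nonintegrable_observable mu f.

Definition equidistributed (T : X -> X) (s r : nat) (e : R) (N : nat) : set X :=
  [set x | forall t, t \in levels s%:R r%:R ->
    (`| orbit_mean T N (trunc f t) x - \int[mu]_y trunc f t y | <= e)%R].

(** Scheme [i], of accuracy [1 / i.+1], is used at the times [N] to which
    [slow_index] assigns [i].  The bounds [M i] after which it may be used are
    left open: they depend on the mode of convergence, almost sure or uniform,
    of the orbit means. *)
Lemma exists_trimming : exists (s r : nat -> nat) (e : nat -> R) (N0 : nat -> nat),
  (forall j, 0 < e j)%R /\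
  forall M : nat -> nat, (forall j, (N0 j <= M j)%N) ->
  exists (k : nat -> nat) (b : nat -> R), admissible_trimming k b /\
    forall j, \forall N \near \oo, exists i, [/\ (j <= i)%N, (M i <= N)%N &
      forall T x, equidistributed T (s i) (r i) (e i) N x ->
        `| normalized_trimmed_sum T (hat f) k b N x - 1 | <= (i.+1%:R^-1)%:E].
Proof.
have eta0 j : (0 < j.+1%:R^-1 :> R)%R by rewrite invr_gt0.
have := choice (fun j => trimming_scheme obs (eta0 j)).
move=> [s] /choice [r] /choice [e] /choice [q] /choice [D] HD.
have HN j : exists N1, forall N, (N1 <= N)%N ->
    let k := (Num.truncn (N%:R * q j)).+1 in
    [/\ (k <= N)%N, (k%:R <= j.+1%:R^-1 * N%:R :> R)%R &
    forall (T : X -> X) x, equidistributed T (s j) (r j) (e j) N x ->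
      `| trimmed_sum T (hat f) N k x * ((N%:R * D j)^-1)%:E - 1 |
        <= (j.+1%:R^-1)%:E].
  have [_ _ [N1 _ HN1]] := HD j; exists N1 => N; exact: HN1.
have {HN}[N0 HN0] := choice HN.
exists s, r, e, N0; split; first by move=> j; have [] := HD j.
move=> M N0M.
have [J [Joo MJ]] := slow_index M.
pose k N := (Num.truncn (N%:R * q (J N))).+1.
pose b N : R := (if N is 0 then 1 else N%:R * D (J N))%R.
exists k, b; split; [split|].
- apply/eqoP => eps eps0.
  have [j0 _ Hj0] := near_infty_natSinv_lt (PosNum eps0).
  near=> N.
  have MN : (M (J N) <= N)%N by near: N.
  have [_ kN _] := HN0 (J N) N (leq_trans (N0M _) MN).
  rewrite !ger0_norm//; apply: le_trans kN _; rewrite ler_wpM2r//.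
  by apply/ltW/Hj0 => /=; near: N; exact: Joo.
- by case=> [|N] //=; have [_ D0 _] := HD (J N.+1); rewrite mulr_gt0.
- move=> j; near=> N; exists (J N).
  have MN : (M (J N) <= N)%N by near: N.
  have [_ _ H] := HN0 (J N) N (leq_trans (N0M _) MN).
  split => //; first by near: N; exact: Joo.
  move=> T x /H; rewrite /normalized_trimmed_sum.
  suff -> : b N = (N%:R * D (J N))%R by [].
  have : (0 < N)%N by near: N; exact: nbhs_infty_gt.
  by rewrite /b; case: (N).
Unshelve. all: by end_near. Qed.

Lemma levels_ge0 (s r : nat) (t : R) : t \in levels s%:R r%:R -> (0 <= t)%R.
Proof. by rewrite /levels !inE => /or4P[] /eqP->; rewrite ?addr_ge0. Qed.

Variable T : X -> X.

Lemma measurable_equidistributed s r e N : measurable_fun setT T ->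
  measurable (equidistributed T s r e N).
Proof.
move=> mT.
have -> : equidistributed T s r e N = \bigcap_(t in [set` levels s%:R r%:R])
  [set x | `|orbit_mean T N (trunc f t) x - \int[mu]_y trunc f t y| <= e]%R by [].
apply: fin_bigcap_measurable => // t _.
pose h x := (`|orbit_mean T N (trunc f t) x - \int[mu]_y trunc f t y|)%R.
have mh : measurable_fun setT h.
  apply: measurableT_comp => //; apply: measurable_funB => //.
  apply: measurable_funM => //; apply: measurable_sum => n.
  apply: measurableT_comp; first exact: (measurable_trunc obs).
  elim: (n : nat) => [|m ih]; first exact: measurable_id.
  exact: measurableT_comp.
rewrite (_ : mkset _ = h @^-1` `]-oo, e]%classic).
  by rewrite -[X in measurable X]setTI; apply: mh.
by apply/seteqP; split => x /=; rewrite in_itv.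
Qed.

Lemma ae_equidistributed s r e : ergodic_system mu T -> (0 < e)%R ->
  {ae mu, forall x, \forall N \near \oo, equidistributed T s r e N x}.
Proof.
move=> ergT e0.
have : {ae mu, forall x, forall t, t \in levels s%:R r%:R ->
    \forall N \near \oo,
      (`|orbit_mean T N (trunc f t) x - \int[mu]_y trunc f t y| <= e)%R}.
  apply: near_seq => t /levels_ge0 t0.
  have := pointwise_ergodic ergT (measurable_trunc obs t)
    (fun x => trunc_bounded obs x t0).
  by apply: filterS => x; apply.
by apply: filterS => x; exact: near_seq.
Qed.

Lemma ae_orbit_finite : ergodic_system mu T ->
  {ae mu, forall x, forall n, f (iter n T x) != +oo}.
Proof.
move=> [mT invT _]; have [_ mf _ f0] := obs; apply: ae_foralln => n.
pose A k := (fun x => f (iter k T x)) @^-1` [set +oo].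
suff [mA A0] : measurable (A n) /\ mu (A n) = 0.
  by exists (A n); split => // x /= /negP; rewrite negbK => /eqP.
elim: n => [|n [mA A0]].
  by split => //; rewrite -[X in measurable X]setTI; exact: mf.
have -> : A n.+1 = T @^-1` A n.
  by apply/seteqP; split => x; rewrite /A /= -iterS iterSr.
by split; [rewrite -[X in measurable X]setTI; exact: mT|rewrite invT].
Qed.

End assembly.

Lemma uniform_equidistributed {d : measure_display} {R : realType}
    {X : borelMetricType d R} (mu : probability X R) (T : X -> X)
    (f : X -> \bar R) s r e :
  nonintegrable_observable mu f -> compact [set: X] -> measurable_fun setT T ->
  continuous T -> uniquely_ergodic mu T -> exp_dist_continuous f -> (0 < e)%R ->
  \forall N \near \oo, forall x, equidistributed mu f T s r e N x.
Proof.
move=> obs cptX mT cT uniqT cf e0; have [f0 _ _ _] := obs.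
have : \forall N \near \oo, forall t, t \in levels s%:R r%:R -> forall x,
    (`|orbit_mean T N (trunc f t) x - \int[mu]_y trunc f t y| <= e)%R.
  apply: near_seq => t /levels_ge0 t0.
  apply: (@uniquely_ergodic_continuous _ _ _ _ _ _ _ _ _ _ t) => //.
  - exact: measurable_trunc obs t.
  - by move=> y; rewrite trunc_ge0 ?trunc_le.
  - by move=> c; exact: closed_trunc_ge.
  - by move=> c; exact: closed_trunc_le.
by apply: filterS => N H x t /H.
Qed.
Theorem theorem2 (R : realType) :
  (forall (d : measure_display) (X : measurableType d)
      (mu : probability X R) (T : X -> X) (f : X -> \bar R),
    ergodic_system mu T ->
    nonintegrable_observable mu f ->
    exists (k : nat -> nat) (b : nat -> R),
      admissible_trimming k b /\
      {ae mu, forall x,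
        normalized_trimmed_sum T f k b N x @[N --> \oo] --> 1}) /\
  (forall (d : measure_display) (X : borelMetricType d R)
      (mu : probability X R) (T : X -> X) (f : X -> \bar R),
    ergodic_system mu T ->
    nonintegrable_observable mu f ->
    compact [set: X] ->
    continuous T ->
    uniquely_ergodic mu T ->
    regular_measure mu ->
    exp_dist_continuous f ->
    exists (k : nat -> nat) (b : nat -> R),
      admissible_trimming k b /\
      forall e : R, (0 < e)%R ->
        \forall N \near \oo, forall x : X,
          `| normalized_trimmed_sum T (hat f) k b N x - 1 | < e%:E).
Proof.
split=> [d X mu T f ergT obs|d X mu T f ergT obs cptX cT uniqT _ cf].
  have [mT _ _] := ergT.
  have [s [r [e [N0 [e0 trim]]]]] := exists_trimming obs.
  have mE j N := measurable_equidistributed obs (s j) (r j) (e j) N mT.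
  have aeE j := ae_equidistributed obs (s j) (r j) ergT (e0 j).
  have [M [N0M aeM]] := eventual_to_uniform N0 mE aeE.
  have [k [b [adm H]]] := trim M N0M.
  exists k, b; split => //.
  apply: filterS2 aeM (ae_orbit_finite obs ergT) => x [j0 _ Ex] finx.
  have hatx N : normalized_trimmed_sum T f k b N x =
      normalized_trimmed_sum T (hat f) k b N x.
    rewrite /normalized_trimmed_sum /trimmed_sum; case: ifP => // _.
    have hatE n : f (iter n T x) = hat f (iter n T x).
      by rewrite /hat (negbTE (finx n)).
    congr ((_ - _) * _); first by apply: eq_bigr => n _.
    by apply: eq_bigr => A _; apply: eq_bigr => n _.
  have near1 (eps : R) : (0 < eps)%R -> \forall N \near \oo,
      `|normalized_trimmed_sum T f k b N x - 1| <= eps%:E.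
    move=> eps0; have [j1 _ Hj1] := near_infty_natSinv_lt (PosNum eps0).
    apply: filterS (H (maxn j0 j1)) => N [i [ij MN Hi]].
    rewrite hatx; apply: le_trans (Hi T x _) _.
      by apply: Ex => //=; exact: leq_trans (leq_maxl _ _) ij.
    rewrite lee_fin; apply/ltW/Hj1 => /=.
    exact: leq_trans (leq_maxr _ _) ij.
  apply/fine_cvgP; split.
    apply: filterS (near1 1%R ltr01) => N.
    by case: (normalized_trimmed_sum _ _ _ _ _ _).
  apply/cvgrPdist_le => eps eps0; apply: filterS (near1 eps eps0) => N /=.
  by case: (normalized_trimmed_sum _ _ _ _ _ _) => //= z; rewrite distrC.
have [mT _ _] := ergT.
have [s [r [e [N0 [e0 trim]]]]] := exists_trimming obs.
have HM j : exists M, (N0 j <= M)%N /\ forall N, (M <= N)%N ->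
    forall x, equidistributed mu f T (s j) (r j) (e j) N x.
  have [n _ Hn] :=
    uniform_equidistributed (s j) (r j) obs cptX mT cT uniqT cf (e0 j).
  exists (maxn (N0 j) n); split; first exact: leq_maxl.
  by move=> N nN; apply: Hn => /=; exact: leq_trans (leq_maxr _ _) nN.
have {HM}[M HM] := choice HM.
have [k [b [adm H]]] := trim M (fun j => (HM j).1).
exists k, b; split => // eps eps0.
have [j1 _ Hj1] := near_infty_natSinv_lt (PosNum eps0).
apply: filterS (H j1) => N [i [ij MN Hi]] x.
apply: le_lt_trans (Hi T x ((HM i).2 N MN x)) _.
by rewrite lte_fin; exact: Hj1.
Qed.
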